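(* Let $p$ be a prime and let $\mathcal{F}$ be a saturated fusion system over a discrete $p$-toral group $S$. Then there exist indecomposable fusion subsystems $\mathcal{E}_1,\dots,\mathcal{E}_k\le\mathcal{F}$ ($k\ge 1$) such that $\mathcal{F}=\mathcal{E}_1\times\cdots\times\mathcal{E}_k$. If $\mathcal{F}=\mathcal{E}_1^*\times\cdots\times\mathcal{E}_m^*$ is another such factorization (that is, another factorization as a product of indecomposable fusion subsystems $\mathcal{E}_j^*\le\mathcal{F}$), then $k=m$, and there are a normal automorphism $\alpha\in\mathrm{Aut}(\mathcal{F})$ and a permutation $\sigma\in\Sigma_k$ such that $\alpha(\mathcal{E}_i)=\mathcal{E}^*_{\sigma(i)}$ for each $i$.
   Context: $\mathbb{Z}/p^\infty$ is the union of the chain $\mathbb{Z}/p\le\mathbb{Z}/p^2\le\cdots$ of finite cyclic $p$-groups. A discrete $p$-toral group is a group $S$ with a normal subgroup $S_0$ such that $S_0$ is isomorphic to a finite product of copies of $\mathbb{Z}/p^\infty$ and $S/S_0$ is a finite $p$-group. For $P,Q\le S$, $\mathrm{Inj}(P,Q)$ is the set of injective homomorphisms $P\to Q$, $\mathrm{Hom}_S(P,Q)$ is the set of homomorphisms $P\to Q$ of the form $x\mapsto c_g(x)=gxg^{-1}$ with $g\in S$, and $\mathrm{Aut}_S(P)=\mathrm{Hom}_S(P,P)\cap\mathrm{Aut}(P)$. A fusion system $\mathcal{F}$ over $S$ is a category whose objects are the subgroups of $S$, with $\mathrm{Hom}_S(P,Q)\subseteq\mathrm{Hom}_{\mathcal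 F}(P,Q)\subseteq\mathrm{Inj}(P,Q)$ for all $P,Q\le S$, and such that every morphism in $\mathcal F$ factors as an isomorphism in $\mathcal F$ followed by an inclusion. Subgroups $P,P'$ are $\mathcal F$-conjugate if they are isomorphic in $\mathcal F$; elements $x,y$ are $\mathcal F$-conjugate if some $\varphi\in\mathrm{Hom}_{\mathcal F}(\langle x\rangle,\langle y\rangle)$ has $\varphi(x)=y$; the conjugacy classes are $P^{\mathcal F}$ and $x^{\mathcal F}$. $P\le S$ is fully automized if the index of $\mathrm{Aut}_S(P)$ in $\mathrm{Aut}_{\mathcal F}(P)$ is finite and prime to $p$; $P$ is receptive if for each $Q\in P^{\mathcal F}$ and each isomorphism $\varphi\in\mathrm{Iso}_{\mathcal F}(Q,P)$, $\varphi$ extends to some $\bar\varphi\in\mathrm{Hom}_{\mathcal F}(N_\varphi,S)$, where $N_\varphi=\{g\in N_S(Q)\mid \varphi c_g\varphi^{-1}\in\mathrm{Aut}_S(P)\}$. $\mathcal F$ is saturated if (i) each $P\le S$ is $\mathcal F$-conjugate to a subgroup that is fully automized and receptive; and (ii) whenever $P_1\le P_2\le\cdots$ are subgroups of $S$ with union $P_\infty$ and $\varphi\in\mathrm{Hom}(P_\infty,S)$ satisfies $\varphi|_{P_n}\in\mathrm{Hom}_{\mathcal F}(P_n,S)$ for all $n$, then $\varphi\in\mathrm{Hom}_{\mathcal F}(P_\infty,S)$. A subgroup $P\le S$ is central in $\mathcal F$ if each $\varphi\in\mathrm{Hom}_{\mathcal F}(Q,R)$ ($Q,R\le S$) extends to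 some $\bar\varphi\in\mathrm{Hom}_{\mathcal F}(QP,RP)$ with $\bar\varphi|_P=\mathrm{Id}_P$. $Z(\mathcal F)$ is the subgroup generated by all subgroups central in $\mathcal F$, and $\mathfrak{foc}(\mathcal F)=\langle xy^{-1}\mid x,y\in S,\ y\in x^{\mathcal F}\rangle$. A fusion subsystem of $\mathcal F$ is a subcategory $\mathcal E$ whose objects are the subgroups of some $T\le S$ and which is a fusion system over $T$. For fusion systems $\mathcal E$ over $T$ and $\mathcal F$ over $S$, a morphism from $\mathcal E$ to $\mathcal F$ is a homomorphism $f\colon T\to S$ for which there is a (necessarily unique) functor $\hat f\colon\mathcal E\to\mathcal F$ with $\hat f(P)=f(P)$ for all $P\le T$ and $\hat f(\varphi)(f(x))=f(\varphi(x))$ for all $\varphi\in\mathrm{Hom}_{\mathcal E}(P,Q)$ and $x\in P$. $\mathrm{Mor}(\mathcal E,\mathcal F)$ is the set of morphisms, and $\mathrm{Aut}(\mathcal F)$ is the group of invertible elements of $\mathrm{Mor}(\mathcal F,\mathcal F)$. For $\alpha\in\mathrm{Aut}(\mathcal F)$ and a subsystem $\mathcal E$, $\alpha(\mathcal E)$ means $\hat\alpha(\mathcal E)$. An automorphism $\alpha\in\mathrm{Aut}(\mathcal F)$ is normal if $\alpha|_{\mathfrak{foc}(\mathcal F)}=\mathrm{Id}$ and $[\alpha,S]\le Z(\mathcal F)$, where $[\alpha,S]=\langle\alpha(x)x^{-1}\mid x\in S\rangle$. The direct product of fusion systems $\mathcal F_i$ over $S_i$ ($1\le i\le k$) is the fusion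 system over $S_1\times\cdots\times S_k$ with $\mathrm{Hom}(P,Q)=\{(\varphi_1,\dots,\varphi_k)|_P \mid \varphi_i\in\mathrm{Hom}_{\mathcal F_i}(\mathrm{pr}_i(P),\mathrm{pr}_i(Q)),\ (\varphi_1,\dots,\varphi_k)(P)\le Q\}$, $\mathrm{pr}_i$ being the projections. Fusion subsystems $\mathcal E_1,\dots,\mathcal E_k\le\mathcal F$ commute if there is a (necessarily unique) morphism $I\in\mathrm{Mor}(\mathcal E_1\times\cdots\times\mathcal E_k,\mathcal F)$ whose restriction to each factor is the inclusion. One writes $\mathcal F=\mathcal E_1\times\cdots\times\mathcal E_k$ if $\mathcal E_1,\dots,\mathcal E_k\le\mathcal F$ commute and $I$ is an isomorphism of fusion systems. A fusion system $\mathcal F$ over $S$ is indecomposable if there are no commuting fusion subsystems $\mathcal E_1,\mathcal E_2\le\mathcal F$ over proper subgroups $T_1,T_2<S$ with $\mathcal F=\mathcal E_1\times\mathcal E_2$.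
   Formalization: Factorizations with at least two factors are required to have all factors over nontrivial groups: the fusion system over the trivial group is indecomposable as defined, so F = F × 1 would otherwise violate k = m. Existence is proved with this extra condition too. *)

(* Defs.v *)
(* Every group below is a subgroup of an ambient group [gT : groupType], which
   may be infinite.  A homomorphism P -> Q between subgroups is represented by
   a function [phi : gT -> gT] of which only the values on P matter; two
   functions that agree on P represent the same homomorphism. *)
From mathcomp Require Import all_boot perm.
From mathcomp Require Import boolp classical_sets functions cardinality.

Set Implicit Arguments.
Unset Strict Implicit.
Unset Printing Implicit Defensive.

Local Open Scope group_scope.
Local Open Scope card_scope.
Local Open Scope classical_set_scope.

Section Groups.
Context {gT hT : groupType}.
Implicit Types (P H A : set gT).

Definition subgroup H := H 1 /\ forall x y, H x -> H y -> H (x * y^-1).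

Definition gen A : set gT := smallest subgroup A.

Definition group_hom P (Q : set hT) (phi : gT -> hT) :=
  (forall x, P x -> Q (phi x)) /\ {in P &, {morph phi : x y / x * y}}.

(* g x g^-1, the inverse convention to that of [x ^ g] *)
Definition conj_by (g x : gT) := g * x * g^-1.

Definition normalizer S P : set gT := [set g | S g /\ conj_by g @` P = P].

Definition lcosets S H : set (set gT) := [set [set g * h | h in H] | g in S].

End Groups.

Definition group_iso {gT hT : groupType} (P : set gT) (Q : set hT)
    (phi : gT -> hT) :=
  [/\ group_hom P Q phi, {in P &, injective phi} & phi @` P = Q].

(* Z is (isomorphic to) Z/p^oo: it is the union of a chain of cyclic subgroups
   of orders p, p^2, p^3, ...; this determines Z up to isomorphism. *)
Definition quasicyclic (p : nat) (Z : groupType) :=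
  exists2 z : nat -> Z,
    forall n, gen [set z n] #= `I_(p ^ n.+1) /\
              gen [set z n] `<=` gen [set z n.+1] &
    \bigcup_n gen [set z n] = setT.

Definition discrete_toral {gT : groupType} (p : nat) (S : set gT) :=
  subgroup S /\
  exists S0 : set gT,
  [/\ [/\ subgroup S0, S0 `<=` S & forall g, S g -> conj_by g @` S0 = S0],
      exists (Z : groupType) (r : nat) (f : gT -> {ffun 'I_r -> Z}),
        quasicyclic p Z /\ group_iso S0 setT f
    & exists n, lcosets S S0 #= `I_(p ^ n)].

(* Only the data are recorded here; the axioms are [fusion_system] below. *)
Record fusion (gT : groupType) := Fusion {
  base : set gT;
  Hom : set gT -> set gT -> set (gT -> gT)
}.

Section Fusion.
Context {gT : groupType}.
Implicit Types (E F : fusion gT) (P Q R S : set gT) (phi psi : gT -> gT).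

Definition obj F P := subgroup P /\ P `<=` base F.

Definition HomS S P Q : set (gT -> gT) :=
  [set phi : gT -> gT | group_hom P Q phi /\
             exists2 g, S g & {in P, phi =1 conj_by g}].

Definition AutS S P : set (gT -> gT) :=
  [set phi | HomS S P P phi /\ group_iso P P phi].

Definition Iso F P Q : set (gT -> gT) :=
  [set phi | Hom F P Q phi /\
     exists psi, [/\ Hom F Q P psi, {in P, cancel phi psi} &
                     {in Q, cancel psi phi}]].

(* [hom_obj] and [hom_ext] pin down the encoding: there are morphisms only
   between objects, and the set of functions representing the morphisms P -> Q
   is closed under changing values outside P.  Hence two fusion systems are
   the same category iff they are equal as elements of [fusion gT]. *)
Record fusion_system F : Prop := {
  base_subgroup : subgroup (base F);
  hom_obj : forall P Q phi, Hom F P Q phi -> obj F P /\ obj F Q;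
  hom_ext : forall P Q phi psi,
    {in P, phi =1 psi} -> Hom F P Q phi -> Hom F P Q psi;
  hom_comp : forall P Q R phi psi,
    Hom F P Q phi -> Hom F Q R psi -> Hom F P R (psi \o phi);
  homS_hom : forall P Q, obj F P -> obj F Q ->
    HomS (base F) P Q `<=` Hom F P Q;
  hom_inj : forall P Q phi, Hom F P Q phi ->
    group_hom P Q phi /\ {in P &, injective phi};
  hom_factor : forall P Q phi, Hom F P Q phi ->
    exists2 R, R `<=` Q & Iso F P R phi
}.

Definition fconj F P Q := exists phi, Iso F P Q phi.

Definition fconj_elt F (x y : gT) :=
  exists2 phi, Hom F (gen [set x]) (gen [set y]) phi & phi x = y.

(* the coset phi A, for A a group of automorphisms of P *)
Definition aut_coset P (A : set (gT -> gT)) phi : set (gT -> gT) :=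
  [set psi : gT -> gT | exists2 a, A a & {in P, psi =1 phi \o a}].

Definition fully_automized (p : nat) F P :=
  exists2 n, [set aut_coset P (AutS (base F) P) phi | phi in Iso F P P] #= `I_n
           & coprime n p.

Definition N_phi S P Q phi : set gT :=
  [set g | normalizer S Q g /\
     exists psi, [/\ {in Q, cancel phi psi}, {in P, cancel psi phi} &
                     AutS S P (phi \o conj_by g \o psi)]].

Definition receptive F P :=
  forall Q phi, Iso F Q P phi ->
  exists2 phibar, Hom F (N_phi (base F) P Q phi) (base F) phibar
                & {in Q, phibar =1 phi}.

Definition saturated (p : nat) F :=
  (forall P, obj F P ->
     exists Q, [/\ fconj F P Q, fully_automized p F Q & receptive F Q]) /\
  (forall (P : nat -> set gT) phi,
     (forall n, obj F (P n) /\ P n `<=` P n.+1) ->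
     group_hom (\bigcup_n P n) (base F) phi ->
     (forall n, Hom F (P n) (base F) phi) ->
     Hom F (\bigcup_n P n) (base F) phi).

Definition setmul P Q : set gT := [set x * y | x in P & y in Q].

Definition central F P :=
  obj F P /\
  forall Q R phi, Hom F Q R phi ->
  exists phibar, [/\ Hom F (setmul Q P) (setmul R P) phibar,
                     {in Q, phibar =1 phi} & {in P, phibar =1 id}].

Definition center F : set gT := gen (\bigcup_(P in central F) P).

Definition foc F : set gT :=
  gen [set z | exists x y,
         [/\ base F x, base F y, fconj_elt F x y & z = x * y^-1]].

Definition subsystem E F :=
  [/\ fusion_system E, base E `<=` base F &
      forall P Q, Hom E P Q `<=` Hom F P Q].

End Fusion.

Section Morphisms.

Record is_functor {gT hT : groupType} (E : fusion gT) (F : fusion hT)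
    (o : set gT -> set hT)
    (m : set gT -> set gT -> (gT -> gT) -> (hT -> hT)) : Prop := {
  functor_obj : forall P, obj E P -> obj F (o P);
  functor_hom : forall P Q phi,
    Hom E P Q phi -> Hom F (o P) (o Q) (m P Q phi);
  functor_ext : forall P Q phi psi, Hom E P Q phi ->
    {in P, phi =1 psi} -> {in o P, m P Q phi =1 m P Q psi};
  functor_id : forall P, obj E P -> {in o P, m P P id =1 id};
  functor_comp : forall P Q R phi psi, Hom E P Q phi -> Hom E Q R psi ->
    {in o P, m P R (psi \o phi) =1 m Q R psi \o m P Q phi}
}.

Definition fus_mor {gT hT : groupType} (E : fusion gT) (F : fusion hT)
    (f : gT -> hT) :=
  group_hom (base E) (base F) f /\
  exists o m,
  [/\ is_functor E F o m,
      forall P, obj E P -> o P = f @` P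
    & forall P Q phi, Hom E P Q phi ->
        forall x, P x -> m P Q phi (f x) = f (phi x)].

Definition fus_iso {gT hT : groupType} (E : fusion gT) (F : fusion hT)
    (f : gT -> hT) :=
  fus_mor E F f /\
  exists g, [/\ fus_mor F E g, {in base E, cancel f g} &
                {in base F, cancel g f}].

Context {gT : groupType}.
Implicit Types (F : fusion gT).

Definition fus_aut F : set (gT -> gT) := [set alpha | fus_iso F F alpha].

(* The image of E under the functor induced by alpha, which sends a morphism
   phi on P to the unique psi on alpha(P) with psi (alpha x) = alpha (phi x). *)
Definition fus_image (alpha : gT -> gT) (E : fusion gT) : fusion gT :=
  {| base := alpha @` base E;
     Hom := fun P Q => [set psi | exists P0 Q0 phi,
       [/\ Hom E P0 Q0 phi, P = alpha @` P0, Q = alpha @` Q0 &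
           forall x, P0 x -> psi (alpha x) = alpha (phi x)]] |}.

Definition normal_aut F (alpha : gT -> gT) :=
  [/\ fus_aut F alpha,
      {in foc F, alpha =1 id}
    & gen [set alpha x * x^-1 | x in base F] `<=` center F].

Section Product.
Context {k : nat}.
Implicit Types (E : 'I_k -> fusion gT).

Definition pr (i : 'I_k) (P : set {ffun 'I_k -> gT}) : set gT :=
  [set v i | v in P].

Definition prod_base E : set {ffun 'I_k -> gT} :=
  [set v | forall i, base (E i) (v i)].

Definition fus_prod E : fusion {ffun 'I_k -> gT} :=
  {| base := prod_base E;
     Hom := fun P Q => [set Phi |
       [/\ subgroup P /\ P `<=` prod_base E, subgroup Q /\ Q `<=` prod_base E,
           Phi @` P `<=` Q
         & exists2 phi : 'I_k -> gT -> gT,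
             forall i, Hom (E i) (pr i P) (pr i Q) (phi i)
           & {in P, Phi =1 fun v => [ffun i => phi i (v i)]}]] |}.

Definition factor_incl (i : 'I_k) (x : gT) : {ffun 'I_k -> gT} :=
  [ffun j => if j == i then x else 1].

Definition commuting_mor F E (I : {ffun 'I_k -> gT} -> gT) :=
  fus_mor (fus_prod E) F I /\
  forall i, {in base (E i), I \o factor_incl i =1 id}.

Definition fus_commute F E := exists I, commuting_mor F E I.

(* F = E_1 x ... x E_k; in particular the E_i commute *)
Definition fus_dprod F E :=
  (forall i, subsystem (E i) F) /\
  exists2 I, commuting_mor F E I & fus_iso (fus_prod E) F I.

End Product.

Definition indecomposable F :=
  ~ exists E : 'I_2 -> fusion gT,
      [/\ forall i, base (E i) `<` base F, fus_commute F E & fus_dprod F E].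

(* The fusion system over the trivial group is indecomposable in the above
   sense, and F = F x 1 for every F.  The number of factors can thus only be
   unique if redundant trivial factors are excluded: when there are at least
   two factors, none of them may be over the trivial group. *)
Definition indecomposable_factorization F (k : nat) (E : 'I_k -> fusion gT) :=
  [/\ (0 < k)%N, fus_dprod F E, forall i, indecomposable (E i)
    & (1 < k)%N -> forall i, base (E i) <> [set 1]].

End Morphisms.

(* Main.v *)
Require Import Defs.
From mathcomp Require Import all_boot perm.
From mathcomp Require Import boolp classical_sets functions cardinality.

Set Implicit Arguments.
Unset Strict Implicit.
Unset Printing Implicit Defensive.

(** The argument is that of the Krull-Remak-Schmidt theorem for groups, with
    the normal endomorphisms of a group (those commuting with all inner
    automorphisms) replaced by endomorphisms [f] of [S] such that [f] and
    [1 - f], the map sending [x] to [f(x)^-1 x], are homomorphisms with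
    commuting images and such that [(x, y) |-> f(x) (1 - f)(y)] is a morphism
    of fusion systems from [F x F] to [F] ([normal_endo]).  They behave like
    the elements of a ring: they are closed under [f |-> 1 - f]
    ([normal_compl]) and composition ([normal_comp]), and every sum that the
    proof needs can be written with these two operations, for instance
    [e + e' = 1 - (1 - e)(1 - e')] for orthogonal idempotents.

    Direct factorizations of [F] correspond to complete families of orthogonal
    idempotents of this kind ([splitting_dprod], [dprod_splitting]), a factor
    being the full subcategory of [F] on the subgroups of the image of its
    idempotent; the factor is indecomposable exactly when this image admits
    no further normal idempotent ([indecomposable_primitive],
    [primitive_indecomposable]).

    An infinite discrete p-toral group has no finite composition length, and
    Krull-Remak-Schmidt fails for artinian modules in general.  What replaces
    finite length is that every endomorphism of [S] has finite orbits
    ([toral_locally_finite]): modulo the torus there are finitely many cosets,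
    and inside the torus there are finitely many elements of a given order.
    Hence for each [x] the sequence [f^(n!) (x)] is eventually constant, and
    its limit is an idempotent that splits [S] into a part on which [f] is
    bijective and a part on which it is locally nilpotent.  Saturation enters
    here: its condition on unions of chains of subgroups is what makes such
    pointwise limits of normal endomorphisms normal ([normal_lim]).  This
    yields Fitting's lemma ([fitting]), then the fact that if a sum acts
    invertibly on an indecomposable factor, so does one of the summands
    ([inv_on_split]), and with it the exchange of the factors one at a time
    ([exchange]).

    The exchange produces a bijective normal endomorphism [a].  The image of
    [1 - a] is central in [F], because it commutes with the image of [a], which
    is all of [S]; and [1 - a] is trivial on the focal subgroup, because
    morphisms of [F] fix the elements of central subgroups.  So [a] is a normal
    automorphism ([normal_endo_aut]).

    For existence, the number of factors of a splitting into nontrivial factors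
    is bounded by the number of cosets of the torus times the number of its
    elements of order dividing [p] ([toral_splitting_bound]), so that repeated
    splitting stops. *)

(** * Subgroups and homomorphisms defined on a subgroup *)

Section Groups.
Local Open Scope group_scope.
Local Open Scope classical_set_scope.
Context {gT hT : groupType}.
Implicit Types (P Q S : set gT) (f g : gT -> gT).

Lemma subgroup1 S : subgroup S -> S 1.
Proof. by case. Qed.

Lemma subgroupV S x : subgroup S -> S x -> S x^-1.
Proof. by case=> S1 SM Sx; rewrite -[x^-1]mul1g; apply: SM. Qed.

Lemma subgroupM S x y : subgroup S -> S x -> S y -> S (x * y).
Proof.
by move=> gS Sx Sy; rewrite -[y]invgK; case: (gS) => _; apply=> //; apply: subgroupV.
Qed.

Lemma subgroupX S x n : subgroup S -> S x -> S (x ^+ n).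
Proof.
move=> gS Sx; elim: n => [|n IHn]; first exact: subgroup1.
by rewrite expgS; apply: subgroupM.
Qed.

Lemma mulgACA_comm (a b c d : gT) : commute b c ->
  (a * b) * (c * d) = (a * c) * (b * d).
Proof. by move=> e; rewrite -!mulgA (mulgA b) e -!mulgA. Qed.

Lemma group_homP P (Q : set hT) phi :
  group_hom P Q phi <->
  (forall x, P x -> Q (phi x)) /\
  (forall x y, P x -> P y -> phi (x * y) = phi x * phi y).
Proof.
split=> -[h1 h2]; split=> // x y.
  by move=> Px Py; apply: h2; apply: mem_set.
by move=> /set_mem Px /set_mem Py; apply: h2.
Qed.

Lemma group_hom1 P (Q : set hT) phi : subgroup P -> group_hom P Q phi -> phi 1 = 1.
Proof.
move=> gP /group_homP[_ hM]; apply: (@mulgI _ (phi 1)).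
by rewrite mulg1 -hM ?mulg1 //; apply: subgroup1.
Qed.

Lemma group_homV P (Q : set hT) phi x : subgroup P -> group_hom P Q phi -> P x ->
  phi x^-1 = (phi x)^-1.
Proof.
move=> gP hphi Px; apply/esym/mulg1_eq.
move/group_homP: (hphi) => [_ hM]; rewrite -hM ?mulgV //; last exact: subgroupV.
exact: group_hom1 hphi.
Qed.

Lemma group_homX P (Q : set hT) phi x n : subgroup P -> group_hom P Q phi -> P x ->
  phi (x ^+ n) = phi x ^+ n.
Proof.
move=> gP hphi Px; elim: n => [|n IHn]; first exact: group_hom1 hphi.
move/group_homP: (hphi) => [_ hM].
by rewrite !expgS hM ?IHn //; apply: subgroupX.
Qed.

Lemma group_hom_sub P P0 (Q Q0 : set hT) phi : group_hom P Q phi -> P0 `<=` P ->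
  (forall x, P0 x -> Q0 (phi x)) -> group_hom P0 Q0 phi.
Proof.
by move=> /group_homP[_ hM] sP hQ; apply/group_homP; split=> // x y /sP ? /sP ?; apply: hM.
Qed.

Lemma subgroup_image P (Q : set hT) phi : subgroup P -> group_hom P Q phi ->
  subgroup (phi @` P).
Proof.
move=> gP hphi; split; first by exists 1; [apply: subgroup1|apply: group_hom1 hphi].
move=> _ _ [x Px <-] [y Py <-]; exists (x * y^-1).
  by case: gP => _; apply.
move/group_homP: (hphi) => [_ hM].
by rewrite hM // ?(group_homV gP hphi) //; apply: subgroupV.
Qed.

Lemma subgroup_setmul P Q : subgroup P -> subgroup Q ->
  (forall x y, P x -> Q y -> commute x y) -> subgroup (setmul P Q).
Proof.
move=> gP gQ cPQ; split.
  by exists 1; [exact: subgroup1|exists 1; [exact: subgroup1|rewrite mulg1]].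
move=> _ _ [x Px [y Qy <-]] [x' Px' [y' Qy' <-]].
exists (x * x'^-1); first by case: gP => _; apply.
exists (y * y'^-1); first by case: gQ => _; apply.
have c : commute x'^-1 (y * y'^-1).
  by apply: cPQ; [exact: subgroupV|case: gQ => _; apply].
by rewrite invgM -!mulgA; congr (_ * _); rewrite [LHS]c mulgA.
Qed.

Lemma subgroup_gen (A : set gT) : subgroup (gen A).
Proof.
split=> [B [gB _]|x y Ax Ay B [gB sAB]]; first exact: subgroup1.
by case: (gB) => _; apply; [apply: Ax|apply: Ay].
Qed.

Lemma gen_min (A S : set gT) : subgroup S -> A `<=` S -> gen A `<=` S.
Proof. by move=> gS sAS x; apply. Qed.

Lemma sub_gen (A : set gT) : A `<=` gen A.
Proof. by move=> x Ax B [_ sAB]; apply: sAB. Qed.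

End Groups.

(** * Morphisms of a fusion system *)

Lemma fusion_eq (gT : groupType) (E E' : fusion gT) : base E = base E' ->
  (forall P Q phi, Hom E P Q phi <-> Hom E' P Q phi) -> E = E'.
Proof.
case: E E' => [B H] [B' H'] /= -> eH; congr Fusion.
by apply/funext=> P; apply/funext=> Q; apply/funext=> phi; apply/propext/eH.
Qed.

Section Fusion.
Local Open Scope group_scope.
Local Open Scope classical_set_scope.
Context {gT : groupType}.
Variable F : fusion gT.
Hypothesis F_fusion : fusion_system F.
Let S := base F.
Implicit Types (P Q R : set gT) (phi psi : gT -> gT).

Lemma Hom_dom P Q phi : Hom F P Q phi -> subgroup P /\ P `<=` S.
Proof. by case/(hom_obj F_fusion). Qed.

Lemma Hom_cod P Q phi : Hom F P Q phi -> subgroup Q /\ Q `<=` S.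
Proof. by case/(hom_obj F_fusion). Qed.

Lemma Hom_mem P Q phi x : Hom F P Q phi -> P x -> Q (phi x).
Proof. by case/(hom_inj F_fusion)=> [[h _] _]; apply: h. Qed.

Lemma Hom_base P Q phi x : Hom F P Q phi -> P x -> S (phi x).
Proof. by move=> h Px; case: (Hom_cod h) => _; apply; apply: Hom_mem h Px. Qed.

Lemma Hom_hom P Q phi : Hom F P Q phi -> group_hom P Q phi.
Proof. by case/(hom_inj F_fusion). Qed.

Lemma HomM P Q phi x y : Hom F P Q phi -> P x -> P y ->
  phi (x * y) = phi x * phi y.
Proof. by move=> /Hom_hom /group_homP[_ h]; apply: h. Qed.

Lemma Hom_ext P Q phi psi : Hom F P Q phi ->
  (forall x, P x -> psi x = phi x) -> Hom F P Q psi.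
Proof. by move=> h e; apply: hom_ext h => // x /set_mem Px; rewrite e. Qed.

Lemma Hom_incl P Q : obj F P -> obj F Q -> P `<=` Q -> Hom F P Q id.
Proof.
move=> oP oQ sPQ; apply: (homS_hom F_fusion) => //; split.
  by apply/group_homP.
exists 1; first by case: (base_subgroup F_fusion).
by move=> x _; rewrite /conj_by mul1g invg1 mulg1.
Qed.

(** The factorization axiom makes the choice of the codomain immaterial. *)
Lemma Hom_restr P Q phi P0 Q0 : Hom F P Q phi ->
  subgroup P0 -> P0 `<=` P -> obj F Q0 -> (forall x, P0 x -> Q0 (phi x)) ->
  Hom F P0 Q0 phi.
Proof.
move=> h gP0 sP0 oQ0 sQ0.
have oP0 : obj F P0 by split=> // x /sP0; case: (Hom_dom h) => _; apply.
have h0 : Hom F P0 Q phi.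
  exact: (hom_comp F_fusion (Hom_incl oP0 (Hom_dom h) sP0) h).
have [R sRQ [hR [psi [hpsi _ psiK]]]] := hom_factor F_fusion h0.
apply: (hom_comp F_fusion hR (Hom_incl (Hom_cod hR) oQ0 _)) => x Rx.
by rewrite -(psiK x (mem_set Rx)); apply: sQ0; apply: Hom_mem hpsi Rx.
Qed.

Lemma obj_trivial : obj F [set 1].
Proof.
split; last by move=> x ->; case: (base_subgroup F_fusion).
by split=> // x y -> ->; rewrite mulgV.
Qed.

Lemma Hom_base_cod P Q phi : Hom F P Q phi -> Hom F P S phi.
Proof.
move=> h; have [gP sP] := Hom_dom h; apply: (Hom_restr h gP) => //.
  by split=> //; exact: base_subgroup F_fusion.
by move=> x; apply: Hom_base h.
Qed.

Lemma Hom_sub P P0 phi : Hom F P S phi -> subgroup P0 -> P0 `<=` P ->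
  Hom F P0 S phi.
Proof.
move=> h gP0 sP0; apply: (Hom_restr h) => //; first exact: Hom_cod h.
by move=> x /sP0; apply: Hom_base h.
Qed.

(** All factors of a direct product are of this form, so that a factorization
    is determined by the subgroups over which the factors are. *)
Definition full (T : set gT) : fusion gT :=
  {| base := T;
     Hom := fun P Q => [set phi | [/\ Hom F P Q phi, P `<=` T & Q `<=` T]] |}.

Lemma full_fusion T : obj F T -> fusion_system (full T).
Proof.
move=> [gT' sT]; split=> //=.
- by move=> P Q phi [h sP sQ]; have [[? ?] [? ?]] := hom_obj F_fusion h.
- by move=> P Q phi psi e [h sP sQ]; split=> //; apply: hom_ext h.
- by move=> P Q R phi psi [h sP sQ] [h' _ sR]; split=> //; apply: hom_comp h h'.
- move=> P Q [gP sP] [gQ sQ] phi [hphi [g Tg e]]; split=> //.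
  apply: (homS_hom F_fusion); [by split=> // x /sP/sT|by split=> // x /sQ/sT|].
  by split=> //; exists g => //; apply: sT.
- by move=> P Q phi [h _ _]; apply: (hom_inj F_fusion).
move=> P Q phi [h sP sQ].
have [R sRQ [hR [psi [hpsi k1 k2]]]] := hom_factor F_fusion h.
exists R => //; split; first by split=> // x /sRQ/sQ.
by exists psi; split=> //; split=> // x /sRQ/sQ.
Qed.

Lemma full_base : full S = F.
Proof.
apply: fusion_eq => // P Q phi; split=> [[]//|h]; split=> //.
  by case: (Hom_dom h).
by case: (Hom_cod h).
Qed.

End Fusion.

(** * Normal endomorphisms *)

Section Normal.
Local Open Scope group_scope.
Local Open Scope classical_set_scope.
Context {gT : groupType}.

(** [1 - f], in additive notation. *)
Definition compl (f : gT -> gT) (x : gT) : gT := (f x)^-1 * x.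

Lemma mul_compl f x : f x * compl f x = x.
Proof. by rewrite /compl mulVKg. Qed.

Variable F : fusion gT.
Hypothesis F_fusion : fusion_system F.
Let S := base F.
Implicit Types (P Q R : set gT) (f g h phi psi : gT -> gT).

(** For the fusion system of a group [S] over itself, whose morphisms are the
    conjugations by elements of [S], this is the usual notion: [f] commutes
    with inner automorphisms if and only if [f(x)] commutes with [(1 - f)(y)]
    for all [x] and [y].  In general [normal_fus] says that [f] and [1 - f]
    together define a morphism from [F x F] to [F]. *)
Record normal_endo f : Prop := NormalEndo {
  normal_hom : group_hom S S f;
  normal_comm : forall x y, S x -> S y -> commute (f x) (compl f y);
  normal_fus : forall P Q phi psi, Hom F P S phi -> Hom F Q S psi ->
    exists2 chi, Hom F (setmul (f @` P) (compl f @` Q)) S chi &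
      forall x y, P x -> Q y ->
        chi (f x * compl f y) = f (phi x) * compl f (psi y)
}.

Let gS : subgroup S. Proof. exact: base_subgroup F_fusion. Qed.
Let oS : obj F S. Proof. by split. Qed.

Lemma normal_mem f x : normal_endo f -> S x -> S (f x).
Proof. by case=> [[h _] _ _]; apply: h. Qed.

Lemma normalM f x y : normal_endo f -> S x -> S y -> f (x * y) = f x * f y.
Proof. by case=> [/group_homP[_ h] _ _]; apply: h. Qed.

Lemma normal1 f : normal_endo f -> f 1 = 1.
Proof. by case=> h _ _; apply: group_hom1 h. Qed.

Lemma normalV f x : normal_endo f -> S x -> f x^-1 = (f x)^-1.
Proof. by case=> h _ _; apply: group_homV h. Qed.

Lemma compl_mem f x : normal_endo f -> S x -> S (compl f x).
Proof.
move=> nf Sx; apply: subgroupM => //; apply: subgroupV => //.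
exact: normal_mem.
Qed.

Lemma mul_compl_comm f x : normal_endo f -> S x -> compl f x * f x = x.
Proof. by move=> nf Sx; rewrite -(normal_comm nf) // mul_compl. Qed.

Lemma complK f x : normal_endo f -> S x -> compl (compl f) x = f x.
Proof.
move=> nf Sx; apply: (@mulgI _ (compl f x)).
by rewrite mul_compl mul_compl_comm.
Qed.

Lemma compl_hom f : normal_endo f -> group_hom S S (compl f).
Proof.
move=> nf; apply/group_homP; split=> [x|x y Sx Sy]; first exact: compl_mem.
rewrite {1}/compl (normalM nf) // invgM -mulgA (mulgA _ x y) -/(compl f x).
have /commuteV c : commute (compl f x) (f y) by apply/commute_sym/normal_comm.
by rewrite [LHS]mulgA -c /compl !mulgA.
Qed.

Lemma complM f x y : normal_endo f -> S x -> S y ->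
  compl f (x * y) = compl f x * compl f y.
Proof. by move/compl_hom/group_homP=> [_ h]; apply: h. Qed.

Lemma subgroup_fimage f P : normal_endo f -> subgroup P -> P `<=` S ->
  subgroup (f @` P).
Proof.
move=> nf gP sP; apply: (@subgroup_image _ _ _ S) => //.
by apply: (group_hom_sub (normal_hom nf) sP) => x /sP; apply: normal_mem.
Qed.

Lemma subgroup_cimage f P : normal_endo f -> subgroup P -> P `<=` S ->
  subgroup (compl f @` P).
Proof.
move=> nf gP sP; apply: (@subgroup_image _ _ _ S) => //.
by apply: (group_hom_sub (compl_hom nf) sP) => x /sP; apply: compl_mem.
Qed.

(** [normal_fus] in the form in which it is applied: the domain of the glued
    morphism may be any subgroup of the product of the images. *)
Lemma normal_glue f P Q R phi psi : normal_endo f ->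
  Hom F P S phi -> Hom F Q S psi -> subgroup R ->
  (forall z, R z -> exists x y, [/\ P x, Q y & z = f x * compl f y]) ->
  exists2 chi, Hom F R S chi &
    forall x y, P x -> Q y -> R (f x * compl f y) ->
      chi (f x * compl f y) = f (phi x) * compl f (psi y).
Proof.
move=> nf hphi hpsi gR hR; have [chi hchi e] := normal_fus nf hphi hpsi.
exists chi; last by move=> x y Px Qy _; apply: e.
apply: (Hom_sub F_fusion hchi) => // z /hR[x [y [Px Qy ->]]]; 
by exists (f x); [exists x|exists (compl f y) => //; exists y].
Qed.

Lemma normal_ext f g : normal_endo f -> (forall x, S x -> g x = f x) ->
  normal_endo g.
Proof.
move=> nf e; have ec x : S x -> compl g x = compl f x.
  by move=> Sx; rewrite /compl e.
split.
- apply/group_homP; split=> [x Sx|x y Sx Sy]; rewrite ?e //; first exact: normal_mem.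
  + by rewrite (normalM nf).
  + exact: subgroupM.
- by move=> x y Sx Sy; rewrite e // ec //; apply: normal_comm.
move=> P Q phi psi hphi hpsi; have [gP sP] := Hom_dom F_fusion hphi.
have [gQ sQ] := Hom_dom F_fusion hpsi.
have -> : g @` P = f @` P by apply: eq_imagel => x /sP; apply: e.
have -> : compl g @` Q = compl f @` Q by apply: eq_imagel => x /sQ; apply: ec.
have [chi hchi echi] := normal_fus nf hphi hpsi; exists chi => // x y Px Qy.
have [Sx Sy] : S x /\ S y by split; [exact: sP|exact: sQ].
have Sx' : S (phi x) by apply: (Hom_base F_fusion hphi).
have Sy' : S (psi y) by apply: (Hom_base F_fusion hpsi).
by rewrite !e // !ec // echi.
Qed.

Lemma normal_compl f : normal_endo f -> normal_endo (compl f).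
Proof.
move=> nf; split.
- exact: compl_hom.
- by move=> x y Sx Sy; rewrite complK //; apply/commute_sym/normal_comm.
move=> P Q phi psi hphi hpsi; have [gP sP] := Hom_dom F_fusion hphi.
have [gQ sQ] := Hom_dom F_fusion hpsi.
have -> : compl (compl f) @` Q = f @` Q.
  by apply: eq_imagel => x /sQ; apply: complK.
have gR : subgroup (setmul (compl f @` P) (f @` Q)).
  apply: subgroup_setmul; [exact: subgroup_cimage|exact: subgroup_fimage|].
  by move=> _ _ [x /sP Sx <-] [y /sQ Sy <-]; apply/commute_sym/normal_comm.
have [|chi hchi e] := normal_glue nf hpsi hphi gR.
  move=> _ [_ [x Px <-] [_ [y Qy <-] <-]]; exists y, x; split=> //.
  by apply/commute_sym/normal_comm; [|exact: sQ|exact: sP].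
exists chi => // x y Px Qy.
have [Sx Sy] : S x /\ S y by split; [exact: sP|exact: sQ].
have Sx' : S (phi x) by apply: (Hom_base F_fusion hphi).
have Sy' : S (psi y) by apply: (Hom_base F_fusion hpsi).
rewrite !complK // -(normal_comm nf) // e // ?(normal_comm nf) //.
by exists (compl f x); [exists x|exists (f y) => //; exists y].
Qed.

Lemma normal_triv : normal_endo (fun=> 1).
Proof.
have c x : compl (fun=> 1 : gT) x = x by rewrite /compl invg1 mul1g.
split.
- by apply/group_homP; split=> [x _|x y _ _]; [exact: subgroup1|rewrite mulg1].
- by move=> x y _ _; apply/commute_sym/commute1.
move=> P Q phi psi hphi hpsi; exists psi; last first.
  by move=> x y _ _; rewrite !c !mul1g.
have -> : setmul ((fun=> 1) @` P) (compl (fun=> 1) @` Q) = Q; last by [].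
have [[P1 _] _] := Hom_dom F_fusion hphi.
apply/seteqP; split=> [_ [_ [x _ <-] [_ [y Qy <-] <-]]|y Qy].
  by rewrite c mul1g.
exists 1; first by exists 1.
by exists y; [exists y => //; rewrite c|rewrite mul1g].
Qed.

Lemma normal_id : normal_endo id.
Proof.
apply: normal_ext (normal_compl normal_triv) _ => x _.
by rewrite /compl invg1 mul1g.
Qed.

(** The complement of a composite is
    [1 - f g = (1 - f) + f (1 - g)], so a morphism defined on the images of
    [f g] and [1 - f g] is obtained by gluing along [g] and then along [f]. *)
Lemma normal_comp f g : normal_endo f -> normal_endo g -> normal_endo (f \o g).
Proof.
move=> nf ng.
have ce x : S x -> compl (f \o g) x = f (compl g x) * compl f x.
  move=> Sx; apply: (@mulgI _ (f (g x))); rewrite [LHS]mul_compl mulgA.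
  by rewrite -(normalM nf) ?mul_compl //; [exact: normal_mem|exact: compl_mem].
have nSg x : S x -> S (g x) by apply: normal_mem.
have nScg x : S x -> S (compl g x) by apply: compl_mem.
have hfg : group_hom S S (f \o g).
  apply/group_homP; split=> [x Sx|x y Sx Sy] /=; first by do 2 apply: normal_mem => //.
  by rewrite (normalM ng) // (normalM nf) //; exact: nSg.
have cfg x y : S x -> S y -> commute ((f \o g) x) (compl (f \o g) y).
  move=> Sx Sy; rewrite ce //; apply: commuteM; last exact: (normal_comm nf (nSg _ Sx) Sy).
  have c : commute (g x) (compl g y) by apply: normal_comm.
  by rewrite /commute /= -!(normalM nf) ?c //; auto.
split=> // P Q phi psi hphi hpsi.
have [gP sP] := Hom_dom F_fusion hphi; have [gQ sQ] := Hom_dom F_fusion hpsi.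
have [chi1 hchi1 e1] := normal_fus ng hphi hpsi.
have [gM1 sM1] := Hom_dom F_fusion hchi1.
have gR : subgroup (setmul ((f \o g) @` P) (compl (f \o g) @` Q)).
  apply: subgroup_setmul.
  - apply: (@subgroup_image _ _ _ S) => //; apply: (group_hom_sub hfg sP) => x /sP Sx.
    by apply: (normal_mem nf); apply: nSg.
  - split.
      exists 1; first exact: subgroup1.
      by rewrite /compl /= (normal1 ng) (normal1 nf) invg1 mul1g.
    move=> _ _ [x Qx <-] [y Qy <-]; exists (x * y^-1); first by case: gQ => _; apply.
    have [Sx Sy] : S x /\ S y by split; apply: sQ.
    have SVy : S y^-1 by apply: subgroupV.
    have cM u v : S u -> S v -> compl (f \o g) (u * v) = compl (f \o g) u * compl (f \o g) v.
      move=> Su Sv; rewrite !ce //; last exact: subgroupM.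
      have [Scu Scv] := conj (nScg _ Su) (nScg _ Sv).
      rewrite (complM ng) // (complM nf) // (normalM nf) //.
      by apply: mulgACA_comm; apply: normal_comm.
    rewrite cM //; congr (_ * _); apply/esym/mulg1_eq; rewrite -cM // mulgV.
    by rewrite /compl /= (normal1 ng) (normal1 nf) invg1 mul1g.
  - by move=> _ _ [x /sP Sx <-] [y /sQ Sy <-]; apply: cfg.
have [|chi hchi e] := normal_glue nf hchi1 hpsi gR.
  move=> _ [_ [x Px <-] [_ [y Qy <-] <-]].
  have [Sx Sy] : S x /\ S y by split; [exact: sP|exact: sQ].
  exists (g x * compl g y), y; split=> //.
    by exists (g x); [exists x|exists (compl g y) => //; exists y].
  by rewrite ce // (normalM nf) ?mulgA //; auto.
exists chi => // x y Px Qy.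
have [Sx Sy] : S x /\ S y by split; [exact: sP|exact: sQ].
have Sx' : S (phi x) by apply: (Hom_base F_fusion hphi).
have Sy' : S (psi y) by apply: (Hom_base F_fusion hpsi).
have eq1 u v : S u -> S v -> (f \o g) u * compl (f \o g) v =
    f (g u * compl g v) * compl f v.
  by move=> Su Sv; rewrite ce // (normalM nf) ?mulgA //; auto.
rewrite !eq1 // e // ?e1 //.
  by exists (g x); [exists x|exists (compl g y) => //; exists y].
rewrite -eq1 //; exists ((f \o g) x); first by exists x.
by exists (compl (f \o g) y) => //; exists y.
Qed.

End Normal.

(** * Limits and Drazin inverses *)

(** The continuity condition in the definition of saturation. *)
Definition chain_closed {gT : groupType} (F : fusion gT) : Prop :=
  forall (P : nat -> set gT) phi,
    (forall n, obj F (P n) /\ (P n `<=` P n.+1)%classic) ->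
    group_hom (\bigcup_n P n)%classic (base F) phi ->
    (forall n, Hom F (P n) (base F) phi) ->
    Hom F (\bigcup_n P n)%classic (base F) phi.

(** Every orbit of every endomorphism is finite. *)
Definition locally_finite_endos {gT : groupType} (S : set gT) : Prop :=
  forall f, group_hom S S f -> forall x, S x ->
    exists i d, (0 < d)%N /\ iter (i + d) f x = iter i f x.

Section Limits.
Local Open Scope group_scope.
Local Open Scope classical_set_scope.
Context {gT : groupType}.
Variable F : fusion gT.
Hypothesis F_fusion : fusion_system F.
Hypothesis F_chain : chain_closed F.
Let S := base F.
Let gS : subgroup S. Proof. exact: base_subgroup F_fusion. Qed.
Local Notation normal_endo := (normal_endo F).
Implicit Types (P Q R T : set gT) (f g h phi psi : gT -> gT).

(** On the subgroups [A P phi n] and [A Q psi n] of elements for which [fs m]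
    and the limit [g] agree for all [m >= n], the glued morphism for [g] is the
    one for [fs n].  These subgroups exhaust [P] and [Q], and saturation allows
    to pass to the union. *)
Lemma normal_lim (fs : nat -> gT -> gT) g : (forall n, normal_endo (fs n)) ->
  (forall x, S x -> exists n0, forall n, (n0 <= n)%N -> fs n x = g x) ->
  normal_endo g.
Proof.
move=> nfs lim.
have lim2 x y : S x -> S y ->
    exists n0, forall n, (n0 <= n)%N -> fs n x = g x /\ fs n y = g y.
  move=> /lim[n hn] /lim[m hm]; exists (maxn n m) => r; rewrite geq_max => /andP[? ?].
  by split; auto.
have gM x y : S x -> S y -> g (x * y) = g x * g y.
  move=> Sx Sy; have [n hn] := lim2 x y Sx Sy.
  have [m hm] := lim _ (subgroupM gS Sx Sy).
  have [e1 e2] := hn _ (leq_maxl n m).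
  by rewrite -(hm (maxn n m)) ?leq_maxr // -e1 -e2 (normalM (nfs _)).
have g_mem x : S x -> S (g x).
  by move=> Sx; have [n hn] := lim _ Sx; rewrite -(hn n) //; apply: (normal_mem (nfs n)).
have hg : group_hom S S g by apply/group_homP.
split=> //.
  move=> x y Sx Sy; have [n hn] := lim2 x y Sx Sy.
  have [e1 e2] := hn n (leqnn n).
  by rewrite /compl -e1 -e2; apply: normal_comm.
move=> P Q phi psi hphi hpsi.
have [gP sP] := Hom_dom F_fusion hphi; have [gQ sQ] := Hom_dom F_fusion hpsi.
pose A (P : set gT) (phi : gT -> gT) n := [set x | P x /\
  forall m, (n <= m)%N -> fs m x = g x /\ fs m (phi x) = g (phi x)].
have A_group P0 phi0 n : Hom F P0 S phi0 -> subgroup (A P0 phi0 n).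
  move=> h0; have [gP0 sP0] := Hom_dom F_fusion h0.
  have h1 := group_hom1 gP0 (Hom_hom F_fusion h0).
  have hV := group_homV gP0 (Hom_hom F_fusion h0).
  have hSM := Hom_base F_fusion h0.
  split; first split; first exact: subgroup1.
    move=> m _; rewrite h1 (normal1 F_fusion (nfs m)).
    by rewrite (group_hom1 gS hg).
  move=> x y [P0x ex] [P0y ey]; have P0yV := subgroupV gP0 P0y.
  split; first by case: gP0 => _; apply.
  move=> m /[dup] /ex[ex1 ex2] /ey[ey1 ey2].
  have [Sx Sy] := conj (sP0 _ P0x) (sP0 _ P0y).
  have [Sx' Sy'] := conj (hSM _ P0x) (hSM _ P0y).
  have [SyV Sy'V] := conj (subgroupV gS Sy) (subgroupV gS Sy').
  rewrite (HomM F_fusion h0) // hV //.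
  rewrite !(normalM (nfs m)) // !(normalV F_fusion (nfs m)) //.
  by rewrite !gM // !(group_homV gS hg) // ex1 ex2 ey1 ey2.
have A_mono P0 phi0 n m : (n <= m)%N -> A P0 phi0 n `<=` A P0 phi0 m.
  by move=> nm x [P0x e]; split=> // r /(leq_trans nm); apply: e.
have A_ex P0 phi0 x : Hom F P0 S phi0 -> P0 x -> exists n, A P0 phi0 n x.
  move=> h0 P0x; have [_ sP0] := Hom_dom F_fusion h0.
  have [n hn] := lim2 x (phi0 x) (sP0 _ P0x) (Hom_base F_fusion h0 P0x).
  by exists n.
have A_sub P0 phi0 n : A P0 phi0 n `<=` P0 by move=> x [].
pose D n := setmul (g @` A P phi n) (compl g @` A Q psi n).
have D_mono n m : (n <= m)%N -> D n `<=` D m.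
  move=> nm _ [_ [x Ax <-] [_ [y By <-] <-]].
  exists (g x); first by exists x => //; apply: A_mono Ax.
  by exists (compl g y) => //; exists y => //; apply: A_mono By.
have glue n : exists2 chi, Hom F (D n) S chi & forall x y, A P phi n x ->
    A Q psi n y -> chi (g x * compl g y) = g (phi x) * compl g (psi y).
  have gA := A_group P phi n hphi; have gB := A_group Q psi n hpsi.
  have hA : Hom F (A P phi n) S phi.
    exact: (Hom_sub F_fusion hphi gA (@A_sub _ _ n)).
  have hB : Hom F (A Q psi n) S psi.
    exact: (Hom_sub F_fusion hpsi gB (@A_sub _ _ n)).
  have [chi hchi e] := normal_fus (nfs n) hA hB.
  have ec y : A Q psi n y -> compl (fs n) y = compl g y.
    by case=> _ /(_ n (leqnn n))[e1 _]; rewrite /compl e1.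
  have eDn : setmul (fs n @` A P phi n) (compl (fs n) @` A Q psi n) = D n.
    congr (setmul _ _); apply: eq_imagel; last exact: ec.
    by move=> x [_ /(_ n (leqnn n))[]].
  rewrite eDn in hchi; exists chi => // x y Ax By; have := e x y Ax By.
  rewrite ec //; case: Ax => _ /(_ n (leqnn n))[-> ->].
  by case: By => _ /(_ n (leqnn n))[_ e2]; rewrite {2}/compl e2.
(* the values prescribed for [chi] are consistent because any two
   decompositions of [z] already live at a common finite stage *)
have /choice[chi chiE] : forall z, exists w, forall x y, P x -> Q y ->
    z = g x * compl g y -> w = g (phi x) * compl g (psi y).
  move=> z; case: (pselect (exists x y, [/\ P x, Q y & z = g x * compl g y])); last first.
    by move=> nz; exists 1 => x y Px Qy ez; case: nz; exists x, y.
  move=> [x0 [y0 [Px0 Qy0 ez0]]]; exists (g (phi x0) * compl g (psi y0)) => x y Px Qy ez.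
  have [n0 A0] := A_ex _ _ _ hphi Px0; have [m0 B0] := A_ex _ _ _ hpsi Qy0.
  have [n1 A1] := A_ex _ _ _ hphi Px; have [m1 B1] := A_ex _ _ _ hpsi Qy.
  pose n := maxn (maxn n0 m0) (maxn n1 m1).
  have [c _ ce] := glue n.
  have l1 : (n0 <= n)%N by rewrite /n !leq_max leqnn.
  have l2 : (m0 <= n)%N by rewrite /n !leq_max leqnn orbT.
  have l3 : (n1 <= n)%N by rewrite /n !leq_max leqnn !orbT.
  have l4 : (m1 <= n)%N by rewrite /n !leq_max leqnn !orbT.
  rewrite -(ce x0 y0); [|exact: A_mono A0|exact: A_mono B0].
  rewrite -(ce x y); [|exact: A_mono A1|exact: A_mono B1].
  by rewrite -ez -ez0.
have hD n : Hom F (D n) S chi.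
  have [c hc ce] := glue n; apply: (Hom_ext F_fusion hc).
  move=> _ [_ [x Ax <-] [_ [y By <-] <-]]; rewrite ce //.
  by apply: chiE => //; [case: Ax|case: By].
have D_all : \bigcup_n D n = setmul (g @` P) (compl g @` Q).
  apply/seteqP; split=> [z [n _ [_ [x Ax <-] [_ [y By <-] <-]]]|].
    by exists (g x); [exists x; case: Ax|exists (compl g y) => //; exists y; case: By].
  move=> _ [_ [x Px <-] [_ [y Qy <-] <-]].
  have [n An] := A_ex _ _ _ hphi Px; have [m Bm] := A_ex _ _ _ hpsi Qy.
  exists (maxn n m) => //; exists (g x).
    by exists x => //; apply: A_mono An; apply: leq_maxl.
  by exists (compl g y) => //; exists y => //; apply: A_mono Bm; apply: leq_maxr.
exists chi; last by move=> x y Px Qy; apply: chiE.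
rewrite -D_all; apply: F_chain => //.
  by move=> n; split; [exact: (Hom_dom F_fusion (hD n))|exact: D_mono].
apply/group_homP; split=> [z [n _ Dz]|z w [n _ Dz] [m _ Dw]].
  exact: (Hom_base F_fusion (hD n)).
apply: (HomM F_fusion (hD (maxn n m))).
  by apply: D_mono Dz; apply: leq_maxl.
by apply: D_mono Dw; apply: leq_maxr.
Qed.

Lemma normal_iter f n : normal_endo f -> normal_endo (iter n f).
Proof.
move=> nf; elim: n => [|n IHn]; first exact: (normal_id F_fusion).
exact: (normal_comp F_fusion nf IHn).
Qed.

Hypothesis S_endos : locally_finite_endos S.

(** If [f^d] fixes [f^i x], then [f^m x] depends only on [m] modulo [d] as soon
    as [m >= i]; hence [f^(n! - 1) x] is eventually constant in [n].  Its limit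
    is the Drazin inverse of [f]: on the periodic points it inverts [f], and it
    kills the points that [f] eventually sends to [1]. *)
Lemma drazin f : normal_endo f -> exists g,
  [/\ normal_endo g, forall x, S x -> f (g x) = g (f x),
      forall x, S x -> g (f (g x)) = g x
    & forall x, S x -> exists n, iter n f (f (g x)) = iter n f x].
Proof.
move=> nf.
have per x : S x -> exists n0, forall n, (n0 <= n)%N ->
    iter n`!.-1 f x = iter n0`!.-1 f x /\
    forall m, (n`!.-1 <= m)%N -> iter (n`! + m) f x = iter m f x.
  move=> Sx; have [i [d [d0 e]]] := S_endos (normal_hom nf) Sx.
  have shift q m : (i <= m)%N -> iter (q * d + m) f x = iter m f x.
    move=> im; elim: q => // q IHq; rewrite mulSn -addnA -IHq.
    have [r ->] : exists r, (q * d + m = r + i)%N.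
      by exists (q * d + m - i)%N; rewrite subnK // (leq_trans im) ?leq_addl.
    by rewrite addnCA iterD [(d + i)%N]addnC e -iterD.
  have dd n : (i.+1 + d <= n)%N -> (d %| n`!)%N.
    by move=> h; rewrite dvdn_fact // d0 (leq_trans _ h) // leq_addl.
  have le n : (i.+1 + d <= n)%N -> (i <= n`!.-1)%N.
    move=> h; rewrite -ltnS prednK ?fact_gt0 //.
    by apply: leq_trans (fact_geq n); apply: leq_trans (leq_addr _ _) h.
  (* for such [n] the number [n! - 1] is at least [i], and [d] divides [n!] *)
  exists (i.+1 + d)%N => n hn; split.
    have mono : ((i.+1 + d)`! <= n`!)%N.
      by rewrite -(bin_fact hn) mulnCA leq_pmulr // muln_gt0 bin_gt0 hn fact_gt0.
    have /dvdnP[q eq] : (d %| n`! - (i.+1 + d)`!)%N by rewrite dvdn_sub ?dd.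
    rewrite -(shift q _ (le _ (leqnn _))) -eq; congr (iter _ f x).
    by rewrite -!subn1 addnBA ?fact_gt0 // subnK.
  move=> m hm; have /dvdnP[q ->] := dd n hn.
  by apply: shift; apply: leq_trans hm; apply: le.
have /choice[g gE] : forall x, exists y, S x -> exists n0, forall n, (n0 <= n)%N ->
    iter n`!.-1 f x = y /\
    forall m, (n`!.-1 <= m)%N -> iter (n`! + m) f x = iter m f x.
  move=> x; case: (pselect (S x)) => [Sx|nSx]; last by exists 1.
  by have [n0 hn0] := per x Sx; exists (iter n0`!.-1 f x) => _; exists n0.
have fS x : S x -> S (f x) by apply: normal_mem.
have ng : normal_endo g.
  apply: (@normal_lim (fun n => iter n`!.-1 f)) => [n|x Sx]; first exact: normal_iter.
  by have [n0 hn0] := gE x Sx; exists n0 => n /hn0[].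
have factS_pred n : n`! = n`!.-1.+1 by rewrite prednK ?fact_gt0.
exists g; split=> // x Sx.
- have [n0 h0] := gE x Sx; have [n1 h1] := gE _ (fS _ Sx).
  have [<- _] := h0 _ (leq_maxl n0 n1); have [<- _] := h1 _ (leq_maxr n0 n1).
  by rewrite -iterS iterSr.
- have Sgx : S (f (g x)) by apply: fS; apply: normal_mem.
  have [n0 h0] := gE x Sx; have [n1 h1] := gE _ Sgx.
  have [e1 p1] := h0 _ (leq_maxl n0 n1); have [e2 _] := h1 _ (leq_maxr n0 n1).
  rewrite -e2 -{2}e1 -[in LHS]e1 -iterS -factS_pred -iterD addnC.
  exact: p1.
have [n0 h0] := gE x Sx; have [e1 p1] := h0 _ (leqnn n0).
exists n0`!; rewrite -e1 -iterS -factS_pred -iterD.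
by apply: p1; rewrite leq_pred.
Qed.

(** * Primitive subgroups and the exchange property *)

Definition trivial_set (T : set gT) := forall x, T x -> x = 1.

Definition idem (f : gT -> gT) := forall x, S x -> f (f x) = f x.

(** Indecomposability of the full subsystem over [T], expressed through normal
    idempotents. *)
Definition primitive T := forall f, normal_endo f -> idem f ->
  f @` S `<=` T -> trivial_set (f @` S) \/ T `<=` f @` S.

(** The inverse of [f] on [T] is asked to come from a normal endomorphism so
    that it can be used in further composites. *)
Definition inv_on T f := exists2 g, normal_endo g &
  forall t, T t -> [/\ T (g t), f (g t) = t & g (f t) = t].

Lemma idem_image e x : idem e -> (e @` S) x -> e x = x.
Proof. by move=> ie [y Sy <-]; apply: ie. Qed.

Lemma image_base f : normal_endo f -> f @` S `<=` S.
Proof. by move=> nf _ [x Sx <-]; apply: normal_mem. Qed.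

Lemma iter1 f n : normal_endo f -> iter n f 1 = 1.
Proof. by move=> nf; elim: n => //= n ->; exact: (normal1 F_fusion nf). Qed.

(** If [g] is the Drazin inverse of [f], then [f^n] takes the same value at
    [f (g x)] and [x] for some [n], and [f^n] is injective. *)
Lemma inj_inv_on f : normal_endo f -> (forall x, S x -> f x = 1 -> x = 1) ->
  inv_on S f.
Proof.
move=> nf finj; have [g [ng fg _ gx]] := drazin nf.
exists g => // t St; rewrite -fg //.
suff: f (g t) = t by split=> //; apply: normal_mem.
have inj n x : S x -> iter n f x = 1 -> x = 1.
  move=> Sx; elim: n => //= n IHn /finj h; apply/IHn/h.
  by apply: normal_mem Sx; apply: normal_iter.
have Sfgt : S (f (g t)) by do 2 apply: normal_mem => //.
have [n e] := gx t St; apply: divg1_eq; apply: (inj n).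
  by apply: (subgroupM gS) => //; apply: (subgroupV gS).
have nfn := normal_iter n nf.
by rewrite (normalM nfn) // ?(normalV F_fusion nfn) // ?e ?mulgV //; apply: subgroupV.
Qed.

(** Fitting's lemma.  The composite of [f] with its Drazin inverse is a normal
    idempotent with image in [T]; by primitivity it is trivial, and then [f] is
    locally nilpotent, or it is the identity on [T]. *)
Lemma fitting T f : primitive T -> normal_endo f -> f @` S `<=` T ->
  (forall x, S x -> exists n, iter n f x = 1) \/ inv_on T f.
Proof.
move=> pT nf sfT; have [g [ng fg gfg gx]] := drazin nf.
have gSm x : S x -> S (g x) by apply: normal_mem.
have fSm x : S x -> S (f x) by apply: normal_mem.
have nfg : normal_endo (f \o g) by apply: normal_comp.
have ifg : idem (f \o g) by move=> x Sx /=; rewrite gfg.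
have sT : (f \o g) @` S `<=` T.
  by move=> _ [x Sx <-]; apply: sfT; exists (g x) => //; apply: gSm.
case: (pT _ nfg ifg sT) => [triv|full]; [left=> x Sx|right].
  have [n e] := gx x Sx; exists n; rewrite -e (triv (f (g x))) ?iter1 //.
  by exists x.
exists g => // t /[dup] Tt /full Ht; have := idem_image ifg Ht => /= e.
have St : S t by apply: image_base Ht.
split=> //; last by rewrite -fg.
by apply: sfT; exists (g (g t)); [apply/gSm/gSm|rewrite fg ?gfg //; exact: gSm].
Qed.

Lemma inv_on_nontrivial T f : ~ trivial_set T -> inv_on T f ->
  ~ (forall t, T t -> f t = 1).
Proof.
move=> nT [g ng hg] f1; apply: nT => t Tt; have [_ _ <-] := hg t Tt.
by rewrite f1 //; apply: (normal1 F_fusion).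
Qed.

(** This is the locality of the endomorphism ring of an indecomposable module.
    If [g] inverts [e q] on [T], then [a = g e q h] and [b = g e q (1 - h)] have
    sum [1] on [T].  If [a] is locally nilpotent then [b = 1 - a] is injective
    on [T], hence not locally nilpotent, hence invertible. *)
Lemma inv_on_split e q h : let T := e @` S in
  normal_endo e -> idem e -> primitive T -> ~ trivial_set T ->
  normal_endo q -> normal_endo h ->
  inv_on T (e \o q) ->
  inv_on T (e \o q \o h) \/ inv_on T (e \o q \o compl h).
Proof.
move=> T ne ie pT nT nq nh [g ng hg].
have sT : T `<=` S by apply: image_base.
have neq : normal_endo (e \o q) by apply: normal_comp.
have eqT x : S x -> T (e (q x)) by move=> Sx; exists (q x) => //; apply: normal_mem.
have key k : normal_endo k ->
    (forall x, S x -> exists n, iter n (g \o (e \o q \o k)) x = 1) \/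
    inv_on T (e \o q \o k).
  move=> nk; have neqk : normal_endo (e \o q \o k) by apply: normal_comp.
  have kS x : S x -> S (k x) by apply: normal_mem.
  have ngk : normal_endo (g \o (e \o q \o k)) by apply: normal_comp.
  case: (@fitting T _ pT ngk) => [|nil|[g' ng' hg']]; [|by left|right].
    by move=> _ [x Sx <-] /=; case: (hg _ (eqT _ (kS _ Sx))).
  exists (g' \o g) => [|t Tt /=]; first exact: normal_comp.
  have [Tgt e1 e2] := hg t Tt; have [Tg't e3 e4] := hg' _ Tgt.
  have [_ _ e6] := hg' _ Tt.
  split=> //; move: e3 => /= /(congr1 (e \o q)) /=; rewrite /= in e1 *.
  by have [_ /= -> _] := hg _ (eqT _ (kS _ (sT _ Tg't))); rewrite e1.
have nc := normal_compl F_fusion nh.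
case: (key _ nh) => [nil1|]; [|by left]; case: (key _ nc) => [nil2|]; [|by right].
case: nT => t Tt; set a := g \o _ in nil1; set b := g \o _ in nil2.
have bT x : T x -> T (b x).
  move=> /sT Sx; have /eqT/hg[] // : S (compl h x) by apply: compl_mem.
have ab x : T x -> a x * b x = x.
  move=> Tx; have Sx := sT _ Tx; have [_ _ e1] := hg x Tx.
  have [Sh Sch] : S (h x) /\ S (compl h x) by split; [apply: normal_mem|apply: compl_mem].
  have [Seh Sech] : S (e (q (h x))) /\ S (e (q (compl h x))).
    by split; apply/sT/eqT.
  have [Sqh Sqch] : S (q (h x)) /\ S (q (compl h x)) by split; apply: normal_mem.
  rewrite /a /b /= -(normalM ng) // -(normalM ne) // -(normalM nq) // mul_compl.
  exact: e1.
have a1 n x : S x -> a x = x -> iter n a x = x by move=> _ e1; elim: n => //= n ->.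
have binj x : T x -> b x = 1 -> x = 1.
  move=> Tx b1; have := ab x Tx; rewrite b1 mulg1 => ax.
  by have [n <-] := nil1 x (sT _ Tx); rewrite a1 //; apply: sT.
have [n e1] := nil2 t (sT _ Tt); elim: n t Tt e1 => // n IHn t Tt.
by rewrite iterSr => /(IHn _ (bT _ Tt)); apply: binj.
Qed.

(** Completeness of the family is stated as triviality of the joint kernel,
    which for orthogonal idempotents is equivalent to having sum [1], and which
    needs no iterated product in a nonabelian group. *)
Record splitting T (k : nat) (e : 'I_k -> gT -> gT) : Prop := Splitting {
  split_normal : forall i, normal_endo (e i);
  split_idem : forall i, idem (e i);
  split_orth : forall i j x, i != j -> S x -> e i (e j x) = 1;
  split_image : forall i, e i @` S `<=` T;
  split_inj : forall x, T x -> (forall i, e i x = 1) -> x = 1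
}.

Section Exchange.
Variables (k : nat) (e' : 'I_k -> gT -> gT).
Hypothesis e'S : splitting S e'.

(** [1] minus the sum of the idempotents with index in [J]. *)
Let kill (J : seq 'I_k) := foldr (fun j q => q \o compl (e' j)) id J.

Let kill_normal J : normal_endo (kill J).
Proof.
elim: J => [|j J IHJ] /=; first exact: (normal_id F_fusion).
by apply: normal_comp => //; apply: normal_compl => //; apply: split_normal e'S _.
Qed.

Let kill_comp j J x : S x ->
  kill J (e' j x) = (if j \in J then 1 else e' j x) /\
  e' j (kill J x) = (if j \in J then 1 else e' j x).
Proof.
have nJ := kill_normal; have n' := split_normal e'S.
elim: J x => // i J IHJ x Sx; rewrite inE /=.
have SVi : S (e' i x)^-1 by apply: subgroupV => //; apply: normal_mem.
have Sij : S (compl (e' i) x) by apply: compl_mem.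
case: (IHJ x Sx) => IH1 _; case: (IHJ _ Sij) => _ IH2; rewrite IH2; split.
  rewrite [compl _ _]/compl; case: (eqVneq j i) => [<-|ji] /=.
    by rewrite (split_idem e'S) // mulVg; apply: (normal1 F_fusion).
  by rewrite (split_orth e'S) // 1?eq_sym // invg1 mul1g.
have -> : e' j (compl (e' i) x) = if j == i then 1 else e' j x.
  rewrite /compl (normalM (n' j)) // (normalV F_fusion (n' j)) //; last exact: normal_mem.
  case: (eqVneq j i) => [<-|ji]; first by rewrite (split_idem e'S) // mulVg.
  by rewrite (split_orth e'S) // invg1 mul1g.
by case: (j == i) => //=; case: ifP.
Qed.

(** Take the summands away from [1] one after the other: [e (kill J)] acts
    invertibly on the image of [e] for [J] empty and trivially for [J]
    everything.  At the step where invertibility is lost, the summand that is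
    taken away acts invertibly by [inv_on_split]. *)
Lemma exchange_index e : normal_endo e -> idem e -> primitive (e @` S) ->
  ~ trivial_set (e @` S) -> exists j, inv_on (e @` S) (e \o e' j).
Proof.
move=> ne ie pT nT; set T := e @` S.
have sT : T `<=` S by apply: image_base.
have n' := split_normal e'S.
have base0 : inv_on T (e \o id).
  by exists id => [|t Tt]; [exact: normal_id|split; rewrite //= (idem_image ie)].
have: inv_on T (e \o kill (enum 'I_k)) \/ exists j, inv_on T (e \o e' j).
  elim: (enum _) => [|j J [IHJ|]]; [by left| |by right].
  case: (inv_on_split ne ie pT nT (kill_normal J) (n' j) IHJ) => [h|]; [right|by left].
  exists j; case jJ : (j \in J).
    case: (inv_on_nontrivial nT h) => t /sT St /=; case: (kill_comp j J St) => -> _.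
    by rewrite jJ; apply: (normal1 F_fusion).
  case: h => g ng hg; exists g => // t Tt; case: (hg t Tt) => Tg /=.
  case: (kill_comp j J (sT _ Tt)) => -> _; case: (kill_comp j J (sT _ Tg)) => -> _.
  by rewrite jJ.
case=> // h; case: (inv_on_nontrivial nT h) => t /sT St /=.
rewrite (split_inj e'S (x := kill _ t)) ?(normal1 F_fusion) //.
  exact: normal_mem (kill_normal _) St.
by move=> j; case: (kill_comp j (enum 'I_k) St) => _ ->; rewrite mem_enum.
Qed.

End Exchange.

(** The endomorphism [e' e] of the image of [e'] is not locally nilpotent, since
    [e e'] is invertible on the image of [e]; by Fitting's lemma it is onto. *)
Lemma exchange_image e e' : let T := e @` S in let T' := e' @` S in
  normal_endo e -> idem e -> ~ trivial_set T ->
  normal_endo e' -> primitive T' ->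
  inv_on T (e \o e') -> T' `<=` e' @` T.
Proof.
move=> T T' ne ie nT ne' pT' [g ng hg].
have sT : T `<=` S by apply: image_base.
have nd : normal_endo (e' \o e) by apply: normal_comp.
case: (@fitting T' _ pT' nd) => [|nil|[g' ng' hg'] y T'y].
- by move=> _ [x Sx <-]; exists (e x) => //; apply: normal_mem.
- case: nT => t Tt; have St := sT _ Tt.
  have Se't : S (e' t) by apply: normal_mem.
  have [n /(congr1 e)] := nil _ Se't; rewrite (normal1 F_fusion ne).
  have -> m : e (iter m (e' \o e) (e' t)) = iter m.+1 (e \o e') t.
    by elim: m => // m IHm; rewrite iterS [in RHS]iterS -IHm.
  elim: (n.+1) => // m IHm; rewrite iterS => e1; apply: IHm.
  set u := iter m _ t in e1 *; have Tu : T u.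
    rewrite /u; elim: (m) => //= r Tr; exists (e' (iter r (e \o e') t)) => //.
    by apply: normal_mem => //; apply: sT.
  by have [_ _ <-] := hg u Tu; rewrite e1; apply: (normal1 F_fusion).
have [T'g e1 _] := hg' y T'y; rewrite -e1 /=; exists (e (g' y)) => //.
by exists (g' y) => //; apply: image_base T'g.
Qed.

(** The normal automorphism that agrees with [e'] on the image of [e] and with
    the identity on its kernel, namely [1 - (1 - e') e]. *)
Definition swap (e e' : gT -> gT) := compl (compl e' \o e).

Lemma swap_normal e e' : normal_endo e -> normal_endo e' -> normal_endo (swap e e').
Proof.
move=> ne ne'; apply: normal_compl => //; apply: normal_comp => //.
exact: normal_compl.
Qed.

Lemma swap_kernel e e' x : normal_endo e' -> e x = 1 -> swap e e' x = x.
Proof.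
move=> ne' ex; rewrite /swap /compl /= ex (normal1 F_fusion ne').
by rewrite invg1 mulg1 invg1 mul1g.
Qed.

Lemma swap_image e e' x : normal_endo e' -> S x -> e x = x -> swap e e' x = e' x.
Proof.
move=> ne' Sx ex; have -> : swap e e' x = compl (compl e') x.
  by rewrite /swap /compl /= ex.
exact: complK ne' Sx.
Qed.

Lemma swap_inv e e' : normal_endo e -> idem e -> normal_endo e' ->
  inv_on (e @` S) (e \o e') -> inv_on S (swap e e').
Proof.
move=> ne ie ne' [g ng hg]; apply: inj_inv_on => [|x Sx]; first exact: swap_normal.
rewrite (_ : swap e e' x = (compl e' (e x))^-1 * x) // => /mulg1_eq; rewrite invgK => ex.
have Sex : S (e x) by apply: normal_mem.
have Se'x : S (e' (e x)) by apply: normal_mem.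
have e1 : e (e' (e x)) = 1.
  move: (congr1 e ex); rewrite /compl (normalM ne) //; last exact: subgroupV.
  by rewrite (normalV F_fusion ne) // ie // -[RHS]mul1g => /mulIg/eqP; rewrite invg_eq1 => /eqP.
have Tex : (e @` S) (e x) by exists x.
have [_ _ h] := hg _ Tex; rewrite /= e1 (normal1 F_fusion ng) in h.
by rewrite -ex -h /compl (normal1 F_fusion ne') invg1 mulg1.
Qed.

Lemma inv_on_comp f g : normal_endo f -> inv_on S f -> normal_endo g ->
  inv_on S g -> inv_on S (f \o g).
Proof.
move=> nf [f' nf' hf] ng [g' ng' hg]; exists (g' \o f'); first exact: normal_comp.
move=> x Sx /=; have [Sf e1 _] := hf x Sx; have [Sg e2 _] := hg _ Sf.
split=> //; first by rewrite e2.
have Sgx : S (g x) by apply: normal_mem.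
by have [_ _ ->] := hf _ Sgx; have [_ _ ->] := hg _ Sx.
Qed.

Section Transport.
Variables (a b : gT -> gT).
Hypotheses (na : normal_endo a) (nb : normal_endo b).
Hypotheses (abK : forall x, S x -> a (b x) = x) (baK : forall x, S x -> b (a x) = x).

Let aS x : S x -> S (a x). Proof. exact: normal_mem. Qed.
Let bS x : S x -> S (b x). Proof. exact: normal_mem. Qed.

Lemma transport_image f : normal_endo f -> (a \o f \o b) @` S = a @` (f @` S).
Proof.
move=> nf; apply/seteqP; split=> [_ [x Sx <-]|_ [_ [x Sx <-] <-]] /=.
  by exists (f (b x)) => //; exists (b x) => //; apply: bS.
by exists (a x); [exact: aS|rewrite /= baK].
Qed.

Lemma transport_normal f : normal_endo f -> normal_endo (a \o f \o b).
Proof. by move=> nf; do 2 apply: normal_comp => //. Qed.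

Lemma transport_splitting k (e : 'I_k -> gT -> gT) : splitting S e ->
  splitting S (fun i => a \o e i \o b).
Proof.
case=> ne ie oe se je; split.
- by move=> i; apply: transport_normal.
- by move=> i x Sx /=; rewrite baK ?ie //; [exact: bS|apply: normal_mem (ne i) (bS Sx)].
- move=> i j x ij Sx /=; rewrite baK ?oe //; [exact: (normal1 F_fusion na)|exact: bS|].
  exact: normal_mem (ne j) (bS Sx).
- by move=> i; apply: image_base; apply: transport_normal.
move=> x Sx h; rewrite -(abK Sx) (je (b x)) ?(normal1 F_fusion na) //; first exact: bS.
move=> i; have := h i => /= /(congr1 b); rewrite (normal1 F_fusion nb) baK //.
exact: normal_mem (ne i) (bS Sx).
Qed.

End Transport.

Lemma transport_primitive a b T : normal_endo a -> normal_endo b ->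
  (forall x, S x -> a (b x) = x) -> (forall x, S x -> b (a x) = x) ->
  T `<=` S -> primitive T -> primitive (a @` T).
Proof.
move=> na nb abK baK sT pT f nf i_f sf.
have aS x : S x -> S (a x) by apply: normal_mem.
have bS x : S x -> S (b x) by apply: normal_mem.
have fS x : S x -> S (f x) by apply: normal_mem.
have im : (b \o f \o a) @` S = b @` (f @` S) by apply: transport_image.
have := pT (b \o f \o a); rewrite im; case.
- exact: transport_normal.
- by move=> x Sx /=; rewrite abK ?i_f //; auto.
- by move=> _ [_ [x Sx <-] <-]; have [|t Tt <-] := sf (f x); [exists x|rewrite baK //; apply: sT].
- move=> triv; left=> _ [x Sx <-]; rewrite -(abK _ (fS _ Sx)).
  rewrite (triv (b (f x))) ?(normal1 F_fusion na) //.
  by exists (f x) => //; exists x.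
- move=> full; right=> _ [t /full[_ [x Sx <-] <-] <-]; rewrite (abK _ (fS _ Sx)).
  by exists x.
Qed.

(** The [r]-th step replaces the [r]-th (already moved) factor by a factor of
    the second splitting, moving the other factors by the identity.  The new
    index differs from the earlier ones: the projection to the moved [r]-th
    factor kills the factors of the second splitting that have been reached. *)
Theorem exchange k m (e : 'I_k -> gT -> gT) (e' : 'I_m -> gT -> gT) :
  splitting S e -> splitting S e' ->
  (forall i, primitive (e i @` S) /\ ~ trivial_set (e i @` S)) ->
  (forall j, primitive (e' j @` S)) ->
  exists a s, [/\ normal_endo a, inv_on S a, injective s &
    forall i : 'I_k, a @` (e i @` S) = e' (s i) @` S].
Proof.
move=> sp sp' pe pe'.
have claim r : (r <= k)%N -> exists a (s : 'I_k -> 'I_m),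
    [/\ normal_endo a, inv_on S a,
      forall i j : 'I_k, (i < r)%N -> (j < r)%N -> s i = s j -> i = j &
      forall i : 'I_k, (i < r)%N -> a @` (e i @` S) = e' (s i) @` S]; last first.
  have [a [s [na ia si im]]] := claim k (leqnn k).
  by exists a, s; split=> // i *; [apply: si|apply: im].
elim: r => [_|r IHr rk].
  case: (posnP k) => [k0|k_gt0].
    have none (i : 'I_k) : False by have := ltn_ord i; rewrite [X in (_ < X)%N]k0.
    exists id, (fun i => False_rect _ (none i)).
    split=> //; first exact: (normal_id F_fusion).
    by exists id; first exact: (normal_id F_fusion).
  have [j _] := exchange_index sp' (split_normal sp (Ordinal k_gt0))
    (split_idem sp _) (pe _).1 (pe _).2.
  exists id, (fun=> j); split=> //; first exact: (normal_id F_fusion).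
  by exists id; first exact: (normal_id F_fusion).
have [a [s [na ia si im]]] := IHr (ltnW rk).
have [b nb hb] := ia.
have abK x : S x -> a (b x) = x by case/hb.
have baK x : S x -> b (a x) = x by case/hb.
have spa := transport_splitting na nb abK baK sp.
(* the idempotent of the [r]-th factor after the first [r] exchanges *)
pose ir := Ordinal rk; pose er := a \o e ir \o b.
have nr : normal_endo er by exact: (split_normal spa ir).
have idr : idem er by exact: (split_idem spa ir).
have imr i : (a \o e i \o b) @` S = a @` (e i @` S).
  by apply: transport_image => //; apply: split_normal sp i.
have pr : primitive (er @` S).
  rewrite /er imr; apply: transport_primitive na nb abK baK _ (pe ir).1.
  by apply: image_base; apply: split_normal sp ir.
have ntr : ~ trivial_set (er @` S).
  rewrite /er imr => h; apply: (pe ir).2 => _ [x Sx <-].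
  have Sx' : S (e ir x) by apply: normal_mem Sx; apply: split_normal sp ir.
  rewrite -(baK _ Sx') (h (a (e ir x))) ?(normal1 F_fusion nb) //.
  by exists (e ir x) => //; exists x.
have [j ij] := exchange_index sp' nr idr pr ntr.
have n'j := split_normal sp' j.
have kills (i : 'I_k) x : (i < r)%N -> S x -> er ((a \o e i \o b) x) = 1.
  move=> ir' Sx; have := split_orth spa (i := ir) (j := i) _ Sx; apply.
  by rewrite -val_eqE /= neq_ltn ir' orbT.
have j_new (i : 'I_k) : (i < r)%N -> s i <> j.
  move=> ir' sij; case: (inv_on_nontrivial ntr ij) => t Tt /=.
  have St : S t by apply: image_base Tt.
  have : (e' j @` S) (e' j t) by exists t.
  by rewrite -sij -(im i ir') -imr => -[x Sx <-]; apply: kills.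
exists (swap er (e' j) \o a), (fun i : 'I_k => if (i < r)%N then s i else j); split.
- by apply: normal_comp => //; apply: swap_normal.
- by apply: inv_on_comp => //; [exact: swap_normal|exact: swap_inv].
- move=> i i' ir1 i'r; case: ltnP => h; case: ltnP => h' //.
  + exact: si.
  + by move/(j_new _ h).
  + by move/esym/(j_new _ h').
  by move=> _; apply: val_inj; apply/eqP; rewrite eqn_leq (leq_trans _ h') ?(leq_trans _ h).
move=> i ir1; rewrite -(image_comp a (swap er (e' j))) -imr; case: ltnP => h.
  rewrite -im // -imr; apply/seteqP; split.
    by move=> _ [_ [x Sx <-] <-]; exists x; rewrite ?swap_kernel ?kills.
  move=> _ [x Sx <-]; exists ((a \o e i \o b) x); first by exists x.
  by rewrite swap_kernel ?kills.
have -> : i = ir by apply: val_inj; apply/eqP; rewrite eqn_leq h andbT -ltnS.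
rewrite -/er.
have swE t : (er @` S) t -> swap er (e' j) t = e' j t.
  by move=> Tt; apply: swap_image; [|exact: image_base Tt|exact: idem_image Tt].
rewrite (eq_imagel swE); apply/seteqP; split; last exact: exchange_image ij.
by move=> _ [t Tt <-]; exists t => //; apply: image_base Tt.
Qed.

End Limits.

(** * Morphisms of fusion systems *)

Section Morphisms.
Local Open Scope group_scope.
Local Open Scope classical_set_scope.

Lemma obj_image {gT hT : groupType} (E : fusion gT) (F : fusion hT) f P :
  group_hom (base E) (base F) f -> obj E P -> obj F (f @` P).
Proof.
move=> hf [gP sP]; have hfP : group_hom P (base F) f.
  by apply: (group_hom_sub hf sP) => x /sP; case: hf => h _; apply: h.
split; first exact: subgroup_image hfP.
by move=> _ [x /sP Ex <-]; case: hf => h _; apply: h.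
Qed.

(** The functor required by the definition of a morphism exists as soon as each
    morphism can be transported separately: the transported map is determined
    on the image of [f], so that any choice is functorial. *)
Lemma fus_morI {gT hT : groupType} (E : fusion gT) (F : fusion hT) f :
  group_hom (base E) (base F) f ->
  (forall P Q phi psi, Hom E P Q phi -> {in P, phi =1 psi} -> Hom E P Q psi) ->
  (forall P, obj E P -> Hom E P P id) ->
  (forall P Q R phi psi, Hom E P Q phi -> Hom E Q R psi ->
    Hom E P R (psi \o phi) /\ forall x, P x -> Q (phi x)) ->
  (forall P Q phi, Hom E P Q phi -> exists2 psi, Hom F (f @` P) (f @` Q) psi &
    forall x, P x -> psi (f x) = f (phi x)) ->
  fus_mor E F f.
Proof.
move=> hf Eext Eid Ecomp Ef; split=> //.
have /choice[m mE] : forall t : set gT * set gT * (gT -> gT), exists psi,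
    Hom E t.1.1 t.1.2 t.2 -> Hom F (f @` t.1.1) (f @` t.1.2) psi /\
      forall x, t.1.1 x -> psi (f x) = f (t.2 x).
  move=> [[P Q] phi] /=; case: (pselect (Hom E P Q phi)) => [/Ef[psi h1 h2]|n].
    by exists psi.
  by exists (fun=> 1).
exists (fun P => f @` P), (fun P Q phi => m (P, Q, phi)); split=> //; last first.
  by move=> P Q phi /(mE (P, Q, phi))[_ h].
split.
- by move=> P; apply: obj_image.
- by move=> P Q phi /(mE (P, Q, phi))[].
- move=> P Q phi psi h e _ /set_mem[x Px <-].
  have [_ /= -> //] := mE (P, Q, phi) h.
  have [_ /= -> //] := mE (P, Q, psi) (Eext _ _ _ _ h e).
  by rewrite e //; apply: mem_set.
- move=> P /Eid h _ /set_mem[x Px <-].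
  by have [_ /= ->] := mE (P, P, id) h.
move=> P Q R phi psi h1 h2 _ /set_mem[x Px <-] /=.
have [h3 h4] := Ecomp _ _ _ _ _ h1 h2.
have [_ /= -> //] := mE (P, R, psi \o phi) h3.
have [_ /= -> //] := mE (P, Q, phi) h1.
by have [_ /= ->] := mE (Q, R, psi) h2; last exact: h4.
Qed.

Lemma fus_morE {gT hT : groupType} (E : fusion gT) (F : fusion hT) f P Q phi :
  fus_mor E F f -> obj E P -> obj E Q -> Hom E P Q phi ->
  exists2 psi, Hom F (f @` P) (f @` Q) psi &
    forall x, P x -> psi (f x) = f (phi x).
Proof.
move=> [hf [o [m [fm eo em]]]] oP oQ h; exists (m P Q phi); last exact: em.
by rewrite -!eo //; apply: functor_hom fm _ _ _ h.
Qed.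

Lemma fusion_morI {gT hT : groupType} (E : fusion gT) (F : fusion hT) f :
  fusion_system E -> group_hom (base E) (base F) f ->
  (forall P Q phi, Hom E P Q phi -> exists2 psi, Hom F (f @` P) (f @` Q) psi &
    forall x, P x -> psi (f x) = f (phi x)) ->
  fus_mor E F f.
Proof.
move=> Ef hf h; apply: fus_morI => //.
- by move=> P Q phi psi hp e; apply: hom_ext Ef _ _ _ _ e hp.
- by move=> P oP; apply: Hom_incl.
- move=> P Q R phi psi hp hq; split; first exact: (hom_comp Ef hp hq).
  by move=> x; apply: Hom_mem hp.
Qed.

End Morphisms.

Section Products.
Local Open Scope group_scope.
Local Open Scope classical_set_scope.
Context {gT : groupType} (k : nat) (E : 'I_k -> fusion gT).
Hypothesis E_fusion : forall i, fusion_system (E i).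
Implicit Types (P Q : set {ffun 'I_k -> gT}).

Lemma ffun_mulE (v w : {ffun 'I_k -> gT}) i : (v * w) i = v i * w i.
Proof. by rewrite ffunE. Qed.

Lemma ffun_invE (v : {ffun 'I_k -> gT}) i : v^-1 i = (v i)^-1.
Proof. by rewrite ffunE. Qed.

Lemma ffun_oneE i : (1 : {ffun 'I_k -> gT}) i = 1.
Proof. by rewrite ffunE. Qed.

Lemma prod_base_subgroup : subgroup (prod_base E).
Proof.
split=> [i|v w Ev Ew i]; first by rewrite ffun_oneE; apply: subgroup1 (base_subgroup (E_fusion i)).
by rewrite ffun_mulE ffun_invE; case: (base_subgroup (E_fusion i)) => _; apply.
Qed.

Lemma pr_obj P i : obj (fus_prod E) P -> obj (E i) (pr i P).
Proof.
move=> [gP sP]; split; last by move=> _ [v /sP Ev <-].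
have h : group_hom P (base (E i)) (fun v => v i).
  by apply/group_homP; split=> [v /sP|v w _ _]; [|rewrite ffun_mulE].
exact: subgroup_image gP h.
Qed.

Lemma prod_morI {hT : groupType} (F : fusion hT) f :
  group_hom (prod_base E) (base F) f ->
  (forall P Q phi, Hom (fus_prod E) P Q phi ->
    exists2 psi, Hom F (f @` P) (f @` Q) psi &
    forall x, P x -> psi (f x) = f (phi x)) ->
  fus_mor (fus_prod E) F f.
Proof.
move=> hf h; apply: fus_morI => //.
- move=> P Q Phi Psi [oP oQ sPhi [phi hphi e]] ePsi; split=> //.
    by move=> _ [v Pv <-]; apply: sPhi; exists v => //; rewrite ePsi //; apply: mem_set.
  by exists phi => // v Pv; rewrite -ePsi // e.
- move=> P oP; split=> //; first by move=> _ [v Pv <-].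
  exists (fun=> id) => [i|v _]; first by apply: Hom_incl => //; apply: pr_obj.
  by apply/ffunP => i; rewrite ffunE.
move=> P Q R Phi Psi [oP oQ sPhi [phi hphi ephi]] [_ oR sPsi [psi hpsi epsi]].
have PQ v : P v -> Q (Phi v) by move=> Pv; apply: sPhi; exists v.
split=> //; split=> //.
  by move=> _ [v Pv <-] /=; apply: sPsi; exists (Phi v) => //; apply: PQ.
exists (fun i => psi i \o phi i) => [i|v Pv /=].
  exact: (hom_comp (E_fusion i) (hphi i) (hpsi i)).
rewrite epsi; last by apply/mem_set/PQ/set_mem.
by rewrite ephi //; apply/ffunP => i; rewrite !ffunE.
Qed.

End Products.

Section NormalMorphisms.
Local Open Scope group_scope.
Local Open Scope classical_set_scope.
Context {gT : groupType}.
Variable F : fusion gT.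
Hypothesis F_fusion : fusion_system F.
Let S := base F.
Let gS : subgroup S. Proof. exact: base_subgroup F_fusion. Qed.
Local Notation normal_endo := (normal_endo F).
Implicit Types (P Q R T : set gT) (f g h phi psi : gT -> gT).

(** A normal endomorphism is in particular a morphism from [F] to [F]: glue with
    the identity of the trivial subgroup. *)
Lemma normal_lift f P Q phi : normal_endo f -> Hom F P Q phi ->
  exists2 psi, Hom F (f @` P) (f @` Q) psi &
    forall x, P x -> psi (f x) = f (phi x).
Proof.
move=> nf h; have [gP sP] := Hom_dom F_fusion h.
have hid : Hom F [set 1] S id.
  apply: (Hom_incl F_fusion) => [||x ->]; [exact: obj_trivial|by split|].
  exact: subgroup1.
have gfP : subgroup (f @` P) by apply: (subgroup_fimage nf).
have c1 : compl f 1 = 1 by rewrite /compl (normal1 F_fusion nf) invg1 mulg1.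
have [|chi hchi e] := normal_glue F_fusion nf (Hom_base_cod F_fusion h) hid gfP.
  by move=> _ [x Px <-]; exists x, 1; split=> //; rewrite c1 mulg1.
have e1 x : P x -> chi (f x) = f (phi x).
  by move=> Px; have := e x 1 Px erefl; rewrite c1 !mulg1; apply; exists x.
exists chi => //; apply: (Hom_restr F_fusion hchi) => //.
  split; first by apply: (subgroup_fimage nf); case: (Hom_cod F_fusion h).
  move=> _ [x Qx <-]; apply: (normal_mem nf).
  by case: (Hom_cod F_fusion h) => _; apply.
by move=> _ [x Px <-]; rewrite e1 //; exists (phi x) => //; apply: (Hom_mem F_fusion h).
Qed.

Lemma normal_fus_mor f : normal_endo f -> fus_mor F F f.
Proof.
move=> nf; apply: fusion_morI => //; first exact: normal_hom.
by move=> P Q phi; apply: normal_lift.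
Qed.

Lemma central_fixed P Q R phi z : central F P -> Hom F Q R phi -> P z -> Q z ->
  phi z = z.
Proof.
move=> [_ cP] h Pz Qz; have [phib [_ e1 e2]] := cP _ _ _ h.
by rewrite -e1 ?e2 //; apply: mem_set.
Qed.

(** When [a] is an automorphism, gluing along [a] the morphism
    [a^-1 phi a] with the identity of [S] extends [phi] by the identity of the
    image of [1 - a]. *)
Lemma compl_central a : normal_endo a -> inv_on F S a -> central F (compl a @` S).
Proof.
move=> na [b nb hb].
have gC : subgroup (compl a @` S) by apply: (subgroup_cimage F_fusion na).
have sC : compl a @` S `<=` S.
  by move=> _ [x Sx <-]; apply: (compl_mem F_fusion na).
split=> // Q R phi h.
have [gQ sQ] := Hom_dom F_fusion h; have [gR sR] := Hom_cod F_fusion h.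
have [psi hpsi epsi] := normal_lift nb h.
have cC x y : S x -> (compl a @` S) y -> commute x y.
  move=> Sx [z Sz <-]; have [Sb <- _] := hb x Sx; exact: (normal_comm na).
have gQC : subgroup (setmul Q (compl a @` S)).
  by apply: subgroup_setmul => // x y /sQ; apply: cC.
have gRC : subgroup (setmul R (compl a @` S)).
  by apply: subgroup_setmul => // x y /sR; apply: cC.
have oS : obj F S by split.
have hid : Hom F S S id by apply: Hom_incl.
have [|chi hchi e] := normal_glue F_fusion na (Hom_base_cod F_fusion hpsi) hid gQC.
  move=> _ [x Qx [_ [y Sy <-] <-]]; exists (b x), y; split=> //.
  by have [_ -> _] := hb x (sQ _ Qx).
have e1 x y : Q x -> S y -> chi (x * compl a y) = phi x * compl a y.
  move=> Qx Sy; have [_ ex _] := hb x (sQ _ Qx).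
  have [_ epx _] := hb (phi x) (Hom_base F_fusion h Qx).
  have := e (b x) y; rewrite ex epsi // epx; apply=> //.
  by exists x => //; exists (compl a y) => //; exists y.
have c1 : compl a 1 = 1 by rewrite /compl (normal1 F_fusion na) invg1 mulg1.
have S1 : S 1 by apply: subgroup1.
exists chi; split.
- apply: (Hom_restr F_fusion hchi) => //.
    split=> // _ [x Rx [y Cy <-]]; apply: (subgroupM gS); [exact: sR|exact: sC].
  move=> _ [x Qx [_ [y Sy <-] <-]]; rewrite e1 //.
  exists (phi x); first exact: (Hom_mem F_fusion h).
  by exists (compl a y) => //; exists y.
- move=> x /set_mem Qx; have := e1 x 1 Qx S1.
  by rewrite c1 !mulg1.
move=> _ /set_mem[y Sy <-]; have := e1 1 y (subgroup1 gQ) Sy.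
by rewrite mul1g (group_hom1 gQ (Hom_hom F_fusion h)) mul1g.
Qed.

(** Elements conjugate in [F] have conjugate images under [1 - a]; these lie in
    a central subgroup, so they are equal.  Hence [1 - a] vanishes on the
    quotients that generate the focal subgroup. *)
Theorem normal_endo_aut a : normal_endo a -> inv_on F S a -> normal_aut F a.
Proof.
move=> na /[dup] ia [b nb hb].
have cC := compl_central na ia.
have gC : subgroup (compl a @` S) by apply: (subgroup_cimage F_fusion na).
have nc := normal_compl F_fusion na.
split.
- split; first exact: normal_fus_mor.
  exists b; split; first exact: normal_fus_mor.
    by move=> x /set_mem /hb[].
  by move=> x /set_mem /hb[].
- pose Fix := [set x | S x /\ a x = x].
  have gFix : subgroup Fix.
    split; first by split; [exact: subgroup1|exact: (normal1 F_fusion na)].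
    move=> x y [Sx ex] [Sy ey]; have SyV := subgroupV gS Sy.
    split; first exact: subgroupM.
    by rewrite (normalM na) // (normalV F_fusion na) // ex ey.
  suff : foc F `<=` Fix by move=> h x /set_mem /h[].
  apply: gen_min => // _ [x [y [Sx Sy [phi h exy] ->]]].
  have SyV := subgroupV gS Sy.
  split; first exact: subgroupM.
  have [psi hpsi epsi] := normal_lift nc h.
  have gx : gen [set x] x by apply: sub_gen.
  have ec : compl a y = compl a x.
    rewrite -exy -epsi //; apply: central_fixed cC hpsi _ _; first by exists x.
    by exists x.
  have : compl a (x * y^-1) = 1.
    by rewrite (normalM nc) // (normalV F_fusion nc) // ec mulgV.
  by rewrite /compl => /mulg1_eq; rewrite invgK.
apply: gen_min; first exact: subgroup_gen.
move=> _ [x Sx <-]; apply: sub_gen; exists (compl a @` S) => //.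
have -> : a x * x^-1 = (compl a x)^-1.
  by rewrite -{2}(mul_compl_comm na Sx) invgM mulVKg.
by apply: (subgroupV gC); exists x.
Qed.

(** * Direct products and splittings *)

Section SplitProduct.
Variables (T : set gT) (k : nat) (e : 'I_k -> gT -> gT).
Hypotheses (oT : obj F T) (eT : splitting F T e).
Let E i := full F (e i @` S).

Let ne i : normal_endo (e i). Proof. exact: split_normal eT i. Qed.
Let sT : T `<=` S. Proof. by case: oT. Qed.
Let gT' : subgroup T. Proof. by case: oT. Qed.
Let eTm i x : S x -> T (e i x).
Proof. by move=> Sx; apply: (split_image eT (i := i)); exists x. Qed.

Let E_fusion i : fusion_system (E i).
Proof.
apply: full_fusion => //; apply: obj_image (normal_hom (ne i)) _; split=> //.
Qed.

Let inj x y : T x -> T y -> (forall i, e i x = e i y) -> x = y.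
Proof.
move=> Tx Ty exy; apply: divg1_eq; apply: (split_inj eT) => [|i].
  by apply: subgroupM => //; apply: subgroupV.
have Sy := sT Ty; have SVy := subgroupV gS Sy.
rewrite (normalM (ne i)) //; last exact: sT.
by rewrite (normalV F_fusion (ne i)) // exy mulgV.
Qed.

Let surj (v : {ffun 'I_k -> gT}) : prod_base E v ->
  exists x, T x /\ forall i, e i x = v i.
Proof.
move=> Ev; have : exists x, T x /\ forall i, e i x = if i \in enum 'I_k then v i else 1.
  have := enum_uniq 'I_k; elim: (enum _) => [_|j J IHJ /= /andP[jJ uJ]].
    by exists 1; split=> [|i]; [exact: subgroup1|rewrite (normal1 F_fusion (ne i))].
  have [x [Tx ex]] := IHJ uJ; have [y Sy ey] := Ev j.
  have Tvj : T (v j) by rewrite -ey; apply: eTm.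
  exists (x * v j); split=> [|i]; first exact: subgroupM.
  rewrite (normalM (ne i)) //; [|exact: sT|exact: sT].
  rewrite ex inE -ey; case: (eqVneq i j) => [->|ij] /=.
    by rewrite (negbTE jJ) mul1g (split_idem eT).
  by rewrite (split_orth eT) // mulg1.
by move=> [x [Tx ex]]; exists x; split=> // i; rewrite ex mem_enum.
Qed.

(** Morphisms of the factors are glued one factor at a time. *)
Let glue P (phi : 'I_k -> gT -> gT) (A : 'I_k -> set gT) :
  (forall i, Hom F (A i) S (phi i)) ->
  (forall i x, A i x -> (e i @` S) x /\ (e i @` S) (phi i x)) ->
  subgroup P -> P `<=` T -> (forall x i, P x -> A i (e i x)) ->
  exists2 chi, Hom F P S chi & forall x, P x -> T (chi x) /\
    forall i, e i (chi x) = phi i (e i x).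
Proof.
move=> hphi Ae gP sPT PA.
(* [R J] is the part of [T] whose components lie in [A i] for [i] in [J] and
   are trivial for the other indices; on it only these have been glued *)
pose R (J : seq 'I_k) := [set x | T x /\
  forall i, if i \in J then A i (e i x) else e i x = 1].
have gR J : subgroup (R J).
  split; first split; first exact: subgroup1.
    move=> i; rewrite (normal1 F_fusion (ne i)); case: ifP => // _.
    by apply: subgroup1; case: (Hom_dom F_fusion (hphi i)).
  move=> x y [Tx ex] [Ty ey]; have SVy := subgroupV gS (sT Ty).
  split; first by apply: subgroupM => //; apply: subgroupV.
  move=> i; rewrite (normalM (ne i)) //; last exact: sT.
  rewrite (normalV F_fusion (ne i)); last exact: sT.
  move: (ex i) (ey i); case: ifP => _; last by move=> -> ->; rewrite mulgV.
  by case: (Hom_dom F_fusion (hphi i)) => -[_]; auto.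
have oR J : obj F (R J) by split=> // x [/sT].
have [chi hchi echi] : exists2 chi, Hom F (R (enum 'I_k)) S chi &
    forall x, R (enum 'I_k) x -> T (chi x) /\ forall i, e i (chi x) =
      if i \in enum 'I_k then phi i (e i x) else 1.
  have := enum_uniq 'I_k; elim: (enum _) => [_|j J IHJ /= /andP[jJ uJ]].
    exists id; first by apply: (Hom_incl F_fusion (oR _)); [split|move=> x [/sT]].
    by move=> x [Tx ex]; split=> // i; rewrite (ex i).
  have [psi hpsi epsi] := IHJ uJ.
  have decomp x : R (j :: J) x -> A j (e j x) /\ R J (compl (e j) x).
    move=> [Tx ex]; have Sx := sT Tx.
    have SejV : S (e j x)^-1 by apply: subgroupV => //; apply: normal_mem.
    split; first by have := ex j; rewrite inE eqxx.
    split; first by apply: subgroupM => //; apply: subgroupV => //; apply: eTm.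
    move=> i; rewrite /compl (normalM (ne i)) // (normalV F_fusion (ne i)); last exact: normal_mem.
    case: (eqVneq i j) => [->|ij].
      by rewrite (negbTE jJ) (split_idem eT) // mulVg.
    by have := ex i; rewrite inE (negbTE ij) (split_orth eT) // invg1 mul1g.
  have idj x : R (j :: J) x -> x = e j (e j x) * compl (e j) (compl (e j) x).
    move=> [/sT Sx _]; rewrite (split_idem eT) // -{1}(mul_compl (e j) x).
    congr (_ * _); rewrite {2}/compl -[LHS]mul1g; congr (_ * _).
    rewrite /compl (normalM (ne j)) // ?(normalV F_fusion (ne j)) //.
    - by rewrite (split_idem eT) // mulVg invg1.
    - exact: normal_mem.
    - by apply: subgroupV => //; apply: normal_mem.
  have [|chi hchi echi] := normal_glue F_fusion (ne j) (hphi j) hpsi (gR (j :: J)).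
    move=> x Rx; have [Ax Rcx] := decomp x Rx.
    by exists (e j x), (compl (e j) x); split=> //; apply: idj.
  exists chi => // x Rx; have [Ax Rcx] := decomp x Rx.
  have Sx : S x by case: Rx => /sT.
  have -> : chi x = e j (phi j (e j x)) * compl (e j) (psi (compl (e j) x)).
    by rewrite {1}(idj x Rx) echi // -idj.
  have [_ [y Sy ey]] := Ae j _ Ax.
  have [Tpsi ei] := epsi _ Rcx; set z := psi _ in Tpsi ei *.
  have Sz := sT Tpsi.
  have SejV : S (e j z)^-1 by apply: subgroupV => //; apply: normal_mem.
  have Scz : S (compl (e j) z) by apply: (compl_mem F_fusion (ne j)).
  have Sphi : S (phi j (e j x)) by apply: (Hom_base F_fusion (hphi j)).
  split.
    apply: subgroupM => //; first exact: eTm.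
    by apply: subgroupM => //; apply: subgroupV => //; apply: eTm.
  move=> i; rewrite (normalM (ne i)) //; last exact: normal_mem.
  have -> : e i (compl (e j) z) = if i == j then 1 else e i z.
    rewrite /compl (normalM (ne i)) // (normalV F_fusion (ne i)); last exact: normal_mem.
    case: (eqVneq i j) => [->|ij]; first by rewrite (split_idem eT) // mulVg.
    by rewrite (split_orth eT) // invg1 mul1g.
  rewrite inE; case: (eqVneq i j) => [->|ij] /=.
    by rewrite mulg1 (split_idem eT) // -ey (split_idem eT).
  rewrite (split_orth eT) // mul1g ei; case: ifP => // _; congr (phi i _).
  rewrite /compl (normalM (ne i)) //; last by apply: subgroupV => //; apply: normal_mem.
  by rewrite (normalV F_fusion (ne i)) ?(split_orth eT) ?invg1 ?mul1g //; apply: normal_mem.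
have sPR : P `<=` R (enum 'I_k).
  by move=> x Px; split=> [|i]; [exact: sPT|rewrite mem_enum; apply: PA].
exists chi; first exact: (Hom_sub F_fusion hchi).
by move=> x /sPR /echi[Tchi ei]; split=> // i; rewrite ei mem_enum.
Qed.

(** The isomorphism from the external product is the inverse of the map
    [x |-> (e i x)_i], which is injective because the joint kernel is trivial.
    Working with this inverse avoids ordered products of components. *)
Lemma splitting_dprod : fus_commute (full F T) E /\ fus_dprod (full F T) E.
Proof.
suff [I cI iI] : exists2 I, commuting_mor (full F T) E I &
    fus_iso (fus_prod E) (full F T) I.
  split; first by exists I.
  split; last by exists I.
  move=> i; split=> //=; first exact: split_image eT i.
  by move=> P Q phi [h sP sQ]; split=> // x; [move/sP|move/sQ]; apply: split_image eT i x.
have /choice[I IE] : forall v, exists x, prod_base E v -> T x /\ forall i, e i x = v i.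
  move=> v; case: (pselect (prod_base E v)) => [/surj[x hx]|nv]; last by exists 1.
  by exists x.
have IT v : prod_base E v -> T (I v) by move=> /IE[].
have eI v i : prod_base E v -> e i (I v) = v i by move=> /IE[].
have gE := prod_base_subgroup E_fusion.
have hI : group_hom (prod_base E) T I.
  apply/group_homP; split=> // v w Ev Ew.
  have Evw : prod_base E (v * w) by apply: (@subgroupM _ _ v w gE).
  apply: inj => [||i]; [exact: IT|by apply: subgroupM; try exact: IT|].
  by rewrite (normalM (ne i)) ?eI // ?ffun_mulE //; apply/sT/IT.
pose g x := [ffun i => e i x].
have gm x : T x -> prod_base E (g x).
  by move=> /sT Sx i; rewrite ffunE; exists x.
have Ig x : T x -> I (g x) = x.
  move=> Tx; apply: inj => // [|i]; first exact/IT/gm.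
  by rewrite eI ?ffunE //; apply: gm.
have gI v : prod_base E v -> g (I v) = v.
  by move=> Ev; apply/ffunP => i; rewrite ffunE eI.
have fI : fus_mor (fus_prod E) (full F T) I.
  apply: prod_morI => // P Q Phi [[gP sP] [gQ sQ] sPhi [phi hphi ePhi]].
  have gIP : subgroup (I @` P) /\ I @` P `<=` T.
    by apply: (@obj_image _ _ (fus_prod E) (full F T)).
  have [gIQ sIQ] : subgroup (I @` Q) /\ I @` Q `<=` T.
    by apply: (@obj_image _ _ (fus_prod E) (full F T)).
  have [gIP1 sIP1] := gIP.
  have hF i : Hom F (pr i P) S (phi i).
    by case: (hphi i) => h _ _; apply: Hom_base_cod h.
  have [|_ i [v Pv <-]|chi hchi echi] := @glue (I @` P) phi (fun i => pr i P) hF _ gIP1 sIP1.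
  - move=> i x Px; case: (hphi i) => h s1 s2; split; first exact: s1.
    by apply: s2; apply: Hom_mem h Px.
  - by rewrite eI; [exists v|exact: sP].
  have e1 v : P v -> chi (I v) = I (Phi v).
    move=> Pv; have QPhi : Q (Phi v) by apply: sPhi; exists v.
    have [Tchi ei] := echi (I v) (ex_intro2 _ _ v Pv erefl).
    apply: inj => // [|i]; first exact/IT/sQ.
    by rewrite ei (eI _ i (sP _ Pv)) (eI _ i (sQ _ QPhi)) (ePhi v (mem_set Pv)) ffunE.
  exists chi => //; split=> //; apply: (Hom_restr F_fusion hchi) => //.
    by split=> // x /sIQ /sT.
  move=> _ [v Pv <-]; rewrite e1 //; exists (Phi v) => //.
  by apply: sPhi; exists v.
exists I.
  split=> // i x /set_mem Tx /=.
  have Sx : S x by apply: image_base (ne i) _ Tx.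
  have Ef : prod_base E (factor_incl i x).
    move=> j; rewrite ffunE; case: eqP => [->//|_].
    exact: subgroup1 (base_subgroup (E_fusion _)).
  apply: inj => [||j]; [exact: IT|exact: split_image eT i _ Tx|].
  rewrite eI // ffunE; case: (eqVneq j i) => [->|ji].
    by case: Tx => y Sy <-; rewrite (split_idem eT).
  by case: Tx => y Sy <-; rewrite (split_orth eT).
split=> //; exists g; split; first last.
- by move=> x /set_mem; apply: Ig.
- by move=> v /set_mem; apply: gI.
apply: fusion_morI; first exact: full_fusion.
  apply/group_homP; split=> // x y Tx Ty; apply/ffunP => i.
  by rewrite ffun_mulE !ffunE (normalM (ne i)) //; apply: sT.
move=> P Q phi [h sP sQ].
have gh : group_hom T (prod_base E) g.
  apply/group_homP; split=> // x y Tx Ty; apply/ffunP => i.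
  by rewrite ffun_mulE !ffunE (normalM (ne i)) //; apply: sT.
have [gP _] := Hom_dom F_fusion h; have [gQ _] := Hom_cod F_fusion h.
have oGP : subgroup (g @` P) /\ g @` P `<=` prod_base E.
  by apply: (@obj_image _ _ (full F T) (fus_prod E)).
have oGQ : subgroup (g @` Q) /\ g @` Q `<=` prod_base E.
  by apply: (@obj_image _ _ (full F T) (fus_prod E)).
have /choice[psi hpsi] : forall i, exists psi, Hom F (e i @` P) (e i @` Q) psi /\
    forall x, P x -> psi (e i x) = e i (phi x).
  by move=> i; have [psi h1 h2] := normal_lift (ne i) h; exists psi.
have prg i R : pr i (g @` R) = e i @` R.
  by rewrite /pr image_comp; apply: eq_imagel => x _ /=; rewrite ffunE.
have ePhi x : P x -> [ffun i => psi i (g x i)] = g (phi x).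
  by move=> Px; apply/ffunP => i; rewrite !ffunE; case: (hpsi i) => _ ->.
exists (fun v : {ffun 'I_k -> gT} => [ffun i => psi i (v i)]) => //; split=> //.
  by move=> _ [_ [x Px <-] <-]; rewrite ePhi //; exists (phi x) => //; apply: Hom_mem h Px.
exists psi => // i; rewrite !prg; split; first by case: (hpsi i).
  by move=> _ [x /sP/sT Sx <-]; exists x.
by move=> _ [x /sQ/sT Sx <-]; exists x.
Qed.

End SplitProduct.

Section ProductSplit.
Variables (c : gT -> gT) (k : nat) (E : 'I_k -> fusion gT).
Hypotheses (nc : normal_endo c) (ic : idem F c).
Let T := c @` S.
Hypothesis dE : fus_dprod (full F T) E.

Let oT : obj F T.
Proof. by apply: obj_image (normal_hom nc) _; split. Qed.

(** The idempotents are the components [p i] of the inverse [g] of the given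
    isomorphism [I], composed with [c].  To glue [phi] on the image of [p i] with
    [psi] on that of [1 - p i], carry both to the external product by [g], take
    the [i]-th component of the first and the other components of the second,
    and come back by [I].  A morphism between subgroups of the [i]-th factor is
    carried by [g] to a morphism whose [i]-th component is itself, so the factor
    is a full subcategory. *)
Lemma dprod_splitting : exists2 e, splitting F T e &
  forall i, E i = full F (e i @` S).
Proof.
have [sE [I [fI Iincl] [_ [g [fg gI Ig]]]]] := dE.
have [gT' sT] := oT.
have E_fusion i : fusion_system (E i) by case: (sE i).
have gE := prod_base_subgroup E_fusion.
have cT x : S x -> T (c x) by exists x.
have sET i : base (E i) `<=` T by case: (sE i).
have hg : group_hom T (prod_base E) g by case: fg.
have hI : group_hom (prod_base E) T I by case: fI.
have gT_ x : T x -> prod_base E (g x) by case: hg => h _; apply: h.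
have gM x y : T x -> T y -> g (x * y) = g x * g y.
  by case/group_homP: hg => _; apply.
have gV x : T x -> g x^-1 = (g x)^-1 by apply: group_homV hg.
have g1 : g 1 = 1 by apply: group_hom1 hg.
have ginj x y : T x -> T y -> g x = g y -> x = y.
  by move=> Tx Ty exy; rewrite -(Ig x (mem_set Tx)) exy Ig //; apply: mem_set.
have Einc i x : base (E i) x -> prod_base E (factor_incl i x).
  move=> Ex j; rewrite ffunE; case: eqP => [->//|_].
  exact: subgroup1 (base_subgroup (E_fusion _)).
have gE_ i x : base (E i) x -> g x = factor_incl i x.
  move=> Ex; rewrite -[X in g X](Iincl i x (mem_set Ex)) /= gI //.
  exact/mem_set/Einc.
pose p i x := g x i.
have pE i x : T x -> base (E i) (p i x) by move=> /gT_; apply.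
have pT i x : T x -> T (p i x) by move=> /(pE i)/sET.
have pp i x : T x -> g (p i x) = factor_incl i (p i x) by move=> /(pE i)/gE_.
have gc i x : T x -> g (compl (p i) x) = [ffun j => if j == i then 1 else g x j].
  move=> Tx; have TVp : T (p i x)^-1 by apply: subgroupV => //; apply: pT.
  rewrite /compl gM // gV; last exact: pT.
  rewrite pp //; apply/ffunP => j; rewrite ffun_mulE ffun_invE !ffunE.
  by case: eqP => [->|_]; rewrite ?mulVg // invg1 mul1g.
have Tc i x : T x -> T (compl (p i) x).
  by move=> Tx; apply: subgroupM => //; apply: subgroupV => //; apply: pT.
have pM i x y : T x -> T y -> p i (x * y) = p i x * p i y.
  by move=> Tx Ty; rewrite /p gM // ffun_mulE.
have compl_pc i x : S x -> compl (p i \o c) x = compl (p i) (c x) * compl c x.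
  move=> Sx; rewrite /compl /= -mulgA; congr (_ * _).
  by rewrite mulVKg.
pose e i := p i \o c.
have he i : group_hom S S (e i).
  apply/group_homP; split=> [x Sx|x y Sx Sy]; first exact/sT/pT/cT.
  by rewrite /e /= (normalM nc) // pM //; apply: cT.
have eS i x : S x -> S (e i x) by case: (he i) => h _; apply: h.
have comm_p i x y : T x -> T y -> commute (p i x) (compl (p i) y).
  move=> Tx Ty; apply: ginj.
  - by apply: subgroupM => //; [apply: pT|apply: Tc].
  - by apply: subgroupM => //; [apply: Tc|apply: pT].
  have [Tp Tcp] := conj (pT i _ Tx) (Tc i _ Ty).
  rewrite (gM _ _ Tp Tcp) (gM _ _ Tcp Tp) gc // pp //.
  apply/ffunP => j; rewrite !ffun_mulE !ffunE.
  by case: eqP => _; rewrite ?mulg1 ?mul1g.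
have cid t : T t -> c t = t by apply: idem_image.
have comm_e i x y : S x -> S y -> commute (e i x) (compl (e i) y).
  move=> Sx Sy; rewrite compl_pc //; apply: commuteM.
    by apply: comm_p; apply: cT.
  by rewrite /e /= -(cid (p i (c x))); [apply: (normal_comm nc); [apply/sT/pT/cT|]|apply/pT/cT].
have G_fusion : fusion_system (full F T) by apply: full_fusion.
have glue_p i P Q phi psi : Hom F P T phi -> P `<=` T -> Hom F Q T psi -> Q `<=` T ->
  exists2 chi, Hom F (setmul (p i @` P) (compl (p i) @` Q)) T chi &
    forall x y, P x -> Q y -> chi (p i x * compl (p i) y) =
      p i (phi x) * compl (p i) (psi y).
  move=> hphi sP hpsi sQ.
  have [gP _] := Hom_dom F_fusion hphi; have [gQ _] := Hom_dom F_fusion hpsi.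
  have oP : obj (full F T) P by split.
  have oQ : obj (full F T) Q by split.
  have oTT : obj (full F T) T by split.
  have [Phi [oP' _ _ [phi_ hphi_ ephi_]] ePhi] : exists2 Phi,
      Hom (fus_prod E) (g @` P) (g @` T) Phi & forall x, P x -> Phi (g x) = g (phi x).
    by apply: (fus_morE fg oP oTT); split.
  have [Psi [oQ' _ _ [psi_ hpsi_ epsi_]] ePsi] : exists2 Psi,
      Hom (fus_prod E) (g @` Q) (g @` T) Psi & forall x, Q x -> Psi (g x) = g (psi x).
    by apply: (fus_morE fg oQ oTT); split.
  have phE j x : P x -> phi_ j (g x j) = g (phi x) j.
    move=> Px; rewrite -ePhi // ephi_ ?ffunE //.
    by apply: mem_set; exists x.
  have psE j x : Q x -> psi_ j (g x j) = g (psi x) j.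
    move=> Qx; rewrite -ePsi // epsi_ ?ffunE //.
    by apply: mem_set; exists x.
  set R := setmul _ _.
  have hpP : group_hom P T (p i).
    by apply/group_homP; split=> [x /sP|x y /sP ? /sP ?]; [apply: pT|apply: pM].
  have hcQ : group_hom Q T (compl (p i)).
    apply/group_homP; split=> [x /sQ|x y /sQ Tx /sQ Ty]; first exact: Tc.
    apply: ginj; [by apply: Tc; apply: subgroupM|by apply: subgroupM => //; apply: Tc|].
    rewrite gM ?gc //; [|exact: subgroupM|exact: Tc|exact: Tc].
    apply/ffunP => j; rewrite gM // !(ffun_mulE, ffunE).
    by case: eqP => _; rewrite ?mulg1.
  have gR : subgroup R.
    apply: subgroup_setmul; [exact: subgroup_image hpP|exact: subgroup_image hcQ|].
    by move=> _ _ [x /sP Tx <-] [y /sQ Ty <-]; apply: comm_p.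
  have sR : R `<=` T.
    move=> _ [_ [x /sP Tx <-] [_ [y /sQ Ty <-] <-]].
    by apply: subgroupM => //; [apply: pT|apply: Tc].
  have gRe x y : P x -> Q y ->
      g (p i x * compl (p i) y) = [ffun j => if j == i then g x j else g y j].
    move=> /sP Tx /sQ Ty; rewrite gM ?gc ?pp //; [|exact: pT|exact: Tc].
    apply/ffunP => j; rewrite ffun_mulE !ffunE.
    by case: eqP => [->|_]; rewrite ?mulg1 ?mul1g.
  (* [R] decomposes along the [i]-th component and the other ones *)
  pose th j := if j == i then phi_ j else psi_ j.
  pose Th (v : {ffun 'I_k -> gT}) := [ffun j => th j (v j)].
  have ThE x y : P x -> Q y ->
      Th (g (p i x * compl (p i) y)) = g (p i (phi x) * compl (p i) (psi y)).
    move=> Px Qy.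
    have Tphi : T (phi x) by apply: (Hom_mem F_fusion hphi).
    have Tpsi : T (psi y) by apply: (Hom_mem F_fusion hpsi).
    rewrite gRe // gM ?gc ?pp //; [|exact: pT|exact: Tc].
    apply/ffunP => j; rewrite ffun_mulE !ffunE /th.
    by case: eqP => [->|_]; rewrite ?mulg1 ?mul1g ?phE ?psE.
  have gRo : obj (fus_prod E) (g @` R).
    by apply: (@obj_image _ _ (full F T) (fus_prod E)).
  have gTo : obj (fus_prod E) (g @` T).
    by apply: (@obj_image _ _ (full F T) (fus_prod E)).
  have hTh : Hom (fus_prod E) (g @` R) (g @` T) Th.
    split=> //.
      move=> _ [_ [_ [_ [x Px <-] [_ [y Qy <-] <-]] <-] <-]; rewrite ThE //.
      exists (p i (phi x) * compl (p i) (psi y)) => //.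
      apply: subgroupM => //; first exact/pT/(Hom_mem F_fusion hphi).
      exact/Tc/(Hom_mem F_fusion hpsi).
    exists th => // j; rewrite /th.
    have gRj : subgroup (pr j (g @` R)) by case: (pr_obj j gRo).
    have oTj := pr_obj j gTo.
    case: (eqVneq j i) => [ji|ji].
      apply: (Hom_restr (E_fusion j) (hphi_ j)) => //.
        move=> _ [_ [_ [_ [x Px <-] [_ [y Qy <-] <-]] <-] <-].
        by rewrite gRe // ffunE ji eqxx; exists (g x) => //; exists x.
      move=> _ [_ [_ [_ [x Px <-] [_ [y Qy <-] <-]] <-] <-].
      rewrite gRe // ffunE ji eqxx -ji phE //.
      by exists (g (phi x)) => //; exists (phi x) => //; apply: (Hom_mem F_fusion hphi).
    apply: (Hom_restr (E_fusion j) (hpsi_ j)) => //.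
      move=> _ [_ [_ [_ [x Px <-] [_ [y Qy <-] <-]] <-] <-].
      by rewrite gRe // ffunE (negbTE ji); exists (g y) => //; exists y.
    move=> _ [_ [_ [_ [x Px <-] [_ [y Qy <-] <-]] <-] <-].
    rewrite gRe // ffunE (negbTE ji) psE //.
    by exists (g (psi y)) => //; exists (psi y) => //; apply: (Hom_mem F_fusion hpsi).
  have [chi [hchi _ _] echi] := fus_morE fI gRo gTo hTh.
  have IgE A : A `<=` T -> I @` (g @` A) = A.
    move=> sA; rewrite image_comp -[RHS]image_id; apply: eq_imagel => x /sA Tx.
    by apply: Ig; apply: mem_set.
  rewrite !IgE // in hchi; exists chi => // x y Px Qy.
  have Rxy : R (p i x * compl (p i) y).
    by exists (p i x); [exists x|exists (compl (p i) y) => //; exists y].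
  rewrite -{1}(Ig _ (mem_set (sR _ Rxy))) echi; last by exists (p i x * compl (p i) y).
  rewrite ThE // Ig //; apply: mem_set.
  apply: subgroupM => //; first exact/pT/(Hom_mem F_fusion hphi).
  exact/Tc/(Hom_mem F_fusion hpsi).
have ce i x y : S x -> S y -> e i x * compl (e i) y =
    c (p i (c x) * compl (p i) (c y)) * compl c y.
  move=> Sx Sy; rewrite compl_pc // mulgA (cid (p i (c x) * _)) //.
  by apply: subgroupM => //; [apply/pT/cT|apply/Tc/cT].
have ne i : normal_endo (e i).
  split; [exact: he|exact: comm_e|move=> P Q phi psi hphi hpsi].
  have [gP sP] := Hom_dom F_fusion hphi; have [gQ sQ] := Hom_dom F_fusion hpsi.
  have [phi1 hphi1 ephi1] := normal_lift nc hphi.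
  have [psi1 hpsi1 epsi1] := normal_lift nc hpsi.
  have [||chi1 hchi1 echi1] := glue_p i _ _ _ _ hphi1 _ hpsi1 _.
  - by move=> _ [x /sP Sx <-]; apply: cT.
  - by move=> _ [x /sQ Sx <-]; apply: cT.
  have gR : subgroup (setmul (e i @` P) (compl (e i) @` Q)).
    apply: subgroup_setmul.
    - apply: (@subgroup_image _ _ _ S) => //.
      by apply: (group_hom_sub (he i) sP) => x /sP; apply: eS.
    - apply: (@subgroup_image _ _ _ S) => //; apply/group_homP; split.
        move=> x /sQ Sx; by apply: (subgroupM gS) => //; apply: (subgroupV gS) => //; apply: eS.
      move=> x y /sQ Sx /sQ Sy.
      have cV : commute (compl (e i) x) (e i y)^-1.
        by apply: commuteV; apply/commute_sym/comm_e.
      case/group_homP: (he i) => _ heM.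
      rewrite {1}/compl heM // invgM -mulgA (mulgA _ x y) -/(compl (e i) x).
      by rewrite [LHS]mulgA -cV -mulgA.
    by move=> _ _ [x /sP Sx <-] [y /sQ Sy <-]; apply: comm_e.
  have [|chi hchi echi] := normal_glue F_fusion nc (Hom_base_cod F_fusion hchi1) hpsi gR.
    move=> _ [_ [x Px <-] [_ [y Qy <-] <-]].
    exists (p i (c x) * compl (p i) (c y)), y; split=> //; last exact: ce (sP _ Px) (sQ _ Qy).
    exists (p i (c x)); first by exists (c x) => //; exists x.
    by exists (compl (p i) (c y)) => //; exists (c y) => //; exists y.
  exists chi => // x y Px Qy; have [Sx Sy] := conj (sP _ Px) (sQ _ Qy).
  have Cx : (c @` P) (c x) by exists x.
  have Cy : (c @` Q) (c y) by exists y.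
  have Sphi := Hom_base F_fusion hphi Px; have Spsi := Hom_base F_fusion hpsi Qy.
  rewrite (ce i x y) // echi //.
  - by rewrite echi1 // ephi1 // epsi1 // -ce.
  - exists (p i (c x)); first by exists (c x).
    by exists (compl (p i) (c y)) => //; exists (c y).
  by rewrite -ce //; exists (e i x); [exists x|exists (compl (e i) y) => //; exists y].
have pid i x : base (E i) x -> p i x = x.
  by move=> Ex; rewrite /p (gE_ i x Ex) ffunE eqxx.
have baseE i : e i @` S = base (E i).
  apply/seteqP; split=> [_ [x Sx <-]|x Ex]; first exact/pE/cT.
  have Tx := sET i _ Ex; exists x; first exact: sT.
  by rewrite /e /= cid // pid.
exists e.
  split=> //.
  - move=> i x Sx; rewrite /e /= (cid _ (pT i _ (cT _ Sx))).
    by apply: pid; apply/pE/cT.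
  - move=> i j x ij Sx; rewrite /e /= (cid _ (pT j _ (cT _ Sx))).
    rewrite (_ : p i _ = g (p j (c x)) i) // (pp j _ (cT _ Sx)).
    by rewrite ffunE (negbTE ij).
  - by move=> i _ [x Sx <-]; apply/pT/cT.
  move=> x Tx h; apply: ginj => //; first exact: subgroup1.
  rewrite g1; apply/ffunP => i; rewrite ffun_oneE -(h i) /e /= cid //.
move=> i; rewrite baseE; apply: fusion_eq => // P Q phi; split=> [h|[h sP sQ]].
  have [[_ sP] [_ sQ]] := hom_obj (E_fusion i) h.
  by split=> //; have [_ _ sub] := sE i; have [] := sub _ _ _ h.
have sPT : P `<=` T by move=> x /sP/sET.
have sQT : Q `<=` T by move=> x /sQ/sET.
have [gP _] := Hom_dom F_fusion h; have [gQ _] := Hom_cod F_fusion h.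
have hG : Hom (full F T) P Q phi by split.
have [Phi [_ _ _ [phi_ hphi_ ephi_]] ePhi] := fus_morE fg (conj gP sPT) (conj gQ sQT) hG.
have prE A : A `<=` base (E i) -> pr i (g @` A) = A.
  move=> sA; rewrite /pr image_comp -[RHS]image_id; apply: eq_imagel => x /sA.
  exact: pid.
have := hphi_ i; rewrite !prE // => h'; apply: (Hom_ext (E_fusion i) h') => x Px.
have Qphi : Q (phi x) by apply: (Hom_mem F_fusion h).
rewrite -{1}(pid i (phi x) (sQ _ Qphi)) /p -ePhi // ephi_; last by apply: mem_set; exists x.
by rewrite ffunE; congr (phi_ i _); apply: pid; apply: sP.
Qed.

End ProductSplit.

End NormalMorphisms.

(** * Endomorphisms of discrete p-toral groups *)

Section Cardinality.
Local Open Scope classical_set_scope.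
Local Open Scope card_scope.

Lemma pigeonhole T (A : set T) (u : nat -> T) : finite_set A ->
  (forall n, A (u n)) -> exists i d, (0 < d)%N /\ u (i + d)%N = u i.
Proof.
move=> finA Au; apply: contrapT => ninj.
have uinj : {in [set: nat] &, injective u}.
  move=> i j _ _ eij; case: (ltngtP i j) => // h; case: ninj.
    by exists i, (j - i)%N; rewrite subn_gt0 subnKC ?(ltnW h).
  by exists j, (i - j)%N; rewrite subn_gt0 subnKC ?(ltnW h).
apply: infinite_nat; rewrite -(eq_finite_set (inj_card_eq uinj)).
by apply: sub_finite_set finA => _ [n _ <-].
Qed.

Lemma inj_ord_bound T (A : set T) n k (u : 'I_k -> T) : A #= `I_n ->
  (forall i, A (u i)) -> injective u -> (k <= n)%N.
Proof.
move=> An Au uinj; rewrite -card_le_II -(card_le_eqr An).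
have uinj' : {in [set: 'I_k] &, injective u} by move=> i j _ _; apply: uinj.
rewrite (card_le_eql (@card_II k)) -(card_le_eql (inj_card_eq uinj')).
by apply: subset_card_le => _ [i _ <-].
Qed.

Lemma finite_ffun (r : nat) (T : choiceType) (B : set T) : finite_set B ->
  finite_set [set v : {ffun 'I_r -> T} | forall i, B (v i)].
Proof.
move=> /finite_seqP[s ->].
have [->|/set0P[w _]] := eqVneq [set v : {ffun 'I_r -> T} |
    forall i, [set` s] (v i)] set0; first exact: finite_set0.
case: r w => [|r] w.
  apply: (@sub_finite_set _ _ [set w]); last exact: finite_set1.
  by move=> v _; apply/ffunP=> -[].
pose x0 := w ord0.
pose h (G : {ffun 'I_r.+1 -> 'I_(size s)}) := [ffun i => nth x0 s (G i)].
apply: (@sub_finite_set _ _ (h @` setT)).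
  move=> v vs; exists [ffun i => Ordinal (etrans (index_mem (v i) s) (vs i))] => //.
  by apply/ffunP=> i; rewrite !ffunE /= nth_index //; apply: vs.
exact/finite_image/finite_finset.
Qed.

End Cardinality.

Section Quasicyclic.
Local Open Scope group_scope.
Local Open Scope classical_set_scope.
Local Open Scope card_scope.

(** With [m] the order of [z], the powers of [z] form a subgroup with [m]
    elements, so that [m] has to be [N]. *)
Lemma finite_cyclic (Z : groupType) (z : Z) N : gen [set z] #= `I_N ->
  (forall k, z ^+ k = 1 <-> (N %| k)%N) /\
  (forall x, gen [set z] x <-> exists k, x = z ^+ k).
Proof.
move=> cN; have gz : gen [set z] z by apply: sub_gen.
have gX k : gen [set z] (z ^+ k) by exact: (subgroupX k (subgroup_gen _) gz).
have [i [d [d_gt0 e]]] : exists i d, (0 < d)%N /\ z ^+ (i + d) = z ^+ i.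
  by apply: (@pigeonhole _ (gen [set z]) (fun k => z ^+ k)) => //; apply/finite_setP; exists N.
have ex : exists d, (0 < d)%N && (z ^+ d == 1).
  exists d; rewrite d_gt0 /=; apply/eqP; apply: (@mulgI _ (z ^+ i)).
  by rewrite -expgnDr e mulg1.
case: (ex_minnP ex) => m /andP[m_gt0 /eqP zm] m_min.
have zmod k : z ^+ k = z ^+ (k %% m).
  by rewrite {1}(divn_eq k m) expgnDr mulnC expgnA zm expg1n mul1g.
have genE x : gen [set z] x <-> exists k, x = z ^+ k.
  split=> [|[k ->//]]; apply: (@gen_min _ _ [set x | exists k, x = z ^+ k]).
    split; first by exists 0%N.
    move=> _ _ [k ->] [l ->]; exists (k + (m - l %% m))%N.
    rewrite expgnDr; congr (_ * _); apply/mulg1_eq.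
    by rewrite zmod -expgnDr subnKC ?zm // ltnW // ltn_pmod.
  by move=> _ ->; exists 1%N; rewrite expg1.
have z1 k : z ^+ k = 1 <-> (m %| k)%N.
  split=> [|/dvdnP[q ->]]; last by rewrite mulnC expgnA zm expg1n.
  rewrite zmod => e1; rewrite /dvdn; case: posnP => // lt.
  by have := m_min (k %% m)%N; rewrite lt e1 eqxx leqNgt ltn_pmod // => /(_ erefl).
suff -> : N = m by [].
apply/card_eq_II; rewrite -(card_eql cN).
have inj : {in `I_m &, injective (fun k => z ^+ k)}.
  suff lt_case i' j : (i' <= j)%N -> (j < m)%N -> z ^+ i' = z ^+ j -> i' = j.
    move=> i' j /set_mem /= hi /set_mem /= hj; case: (leqP i' j) => h.
      exact: lt_case.
    by move/esym/(lt_case _ _ (ltnW h) hi).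
  move=> le lt; rewrite -(subnKC le) expgnDr -{1}[z ^+ i']mulg1 => /mulgI/esym/z1.
  by rewrite /dvdn modn_small ?(leq_ltn_trans (leq_subr _ _) lt) // => /eqP->; rewrite addn0.
rewrite -(card_eqr (inj_card_eq inj)).
suff -> : (fun k => z ^+ k) @` `I_m = gen [set z] by apply: card_eqxx.
apply/seteqP; split=> [_ [k _ <-] //|x /genE[k ->]].
by exists (k %% m)%N; rewrite /= ?ltn_pmod // -zmod.
Qed.

Variables (p : nat) (Z : groupType).
Hypotheses (p_prime : prime p) (Zqc : quasicyclic p Z).

(** The consequences of the definition through which it is used: [z n] has
    order [p ^ n.+1] and is a power of [z m] for all [m >= n]. *)
Lemma quasicyclic_chain : exists z : nat -> Z, [/\
  forall n k, z n ^+ k = 1 <-> (p ^ n.+1 %| k)%N,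
  forall n m, (n <= m)%N -> exists k, z n = z m ^+ k,
  forall n, finite_set (gen [set z n]) &
  forall x, exists n, forall m, (n <= m)%N -> exists k, x = z m ^+ k].
Proof.
have [z hz zT] := Zqc; exists z.
have cyc n := finite_cyclic (hz n).1.
have mono n m : (n <= m)%N -> gen [set z n] `<=` gen [set z m].
  move=> /subnKC <-; elim: (m - n)%N => [|d IHd]; first by rewrite addn0.
  by rewrite addnS; apply: subset_trans (hz _).2.
split.
- by move=> n; case: (cyc n).
- by move=> n m nm; apply/(cyc m).2; apply: (mono _ _ nm); apply: sub_gen.
- by move=> n; apply/finite_setP; exists (p ^ n.+1)%N; case: (hz n).
move=> x; have : setT x by [].
by rewrite -zT => -[n _ gx]; exists n => m nm; apply/(cyc m).2; apply: (mono _ _ nm).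
Qed.

Lemma quasicyclic_abelian (x y : Z) : commute x y.
Proof.
have [z [_ _ _ cov]] := quasicyclic_chain.
have [[n hn] [m hm]] := (cov x, cov y).
have [k ->] := hn _ (leq_maxl n m); have [l ->] := hm _ (leq_maxr n m).
exact/commuteX2/commute_refl.
Qed.

Lemma quasicyclic_torsion (x : Z) : exists m, x ^+ (p ^ m) = 1.
Proof.
have [z [ord _ _ cov]] := quasicyclic_chain.
have [n /(_ _ (leqnn n))[k ->]] := cov x; exists n.+1.
by rewrite -expgnA mulnC expgnA; have [_ ->] := ord n (p ^ n.+1)%N; rewrite ?expg1n.
Qed.

(** Roots of order prime to [p] exist by Bezout because elements have [p]-power
    order.  For the [p ^ s]-th root of [z n], write [z n] as a power of
    [z (n + s)]; comparison of the orders shows that the exponent is divisible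
    by [p ^ s]. *)
Lemma quasicyclic_divisible (x : Z) q : (0 < q)%N -> exists y, y ^+ q = x.
Proof.
move=> q_gt0; have [m cpm ->] := pfactor_coprime p_prime q_gt0.
have divm (w : Z) : exists v, v ^+ m = w.
  have [t wt] := quasicyclic_torsion w.
  have m_gt0 : (0 < m)%N.
    case: (posnP m) cpm => // ->; rewrite /coprime gcdn0 => /eqP p1.
    by have := prime_gt1 p_prime; rewrite p1.
  have [u v e _] := egcdnP (p ^ t) m_gt0.
  exists (w ^+ u); rewrite -expgnA e expgnDr mulnC expgnA wt expg1n mul1g.
  by have := cpm; rewrite coprime_sym => /(coprimeXr t)/eqP->; rewrite expg1.
have divp (w : Z) s : exists v, v ^+ (p ^ s) = w.
  have [z [ord sub _ cov]] := quasicyclic_chain.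
  have [n /(_ _ (leqnn n))[k ->]] := cov w.
  have [a ea] := sub n (n + s)%N (leq_addr _ _).
  have /dvdnP[b eb] : (p ^ s %| a)%N.
    have : (p ^ (n + s).+1 %| a * p ^ n.+1)%N.
      by apply/ord; rewrite expgnA -ea; apply/ord.
    by rewrite -addSn addnC expnD dvdn_pmul2r ?expn_gt0 ?prime_gt0.
  by exists (z (n + s)%N ^+ (b * k)); rewrite ea eb -!expgnA mulnAC.
have [v <-] := divm x; have [w <-] := divp v (logn p q).
by exists w; rewrite mulnC expgnA.
Qed.

(** For [s = t.+1] this subgroup is generated by [z t]: in the cyclic group
    generated by [z n], with [n >= t], the elements killed by [p ^ t.+1] are the
    powers of [z n ^+ p ^ (n - t)], which is a power of [z t]. *)
Lemma quasicyclic_finite s : finite_set [set x : Z | x ^+ (p ^ s) = 1].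
Proof.
have [z [ord sub fin cov]] := quasicyclic_chain.
have p_gt0 := prime_gt0 p_prime; have pX_gt0 i : (0 < p ^ i)%N by rewrite expn_gt0 p_gt0.
case: s => [|t].
  by apply: (sub_finite_set _ (finite_set1 1)) => x /=; rewrite expg1.
apply: sub_finite_set (fin t) => x /= xt.
have [n0 hn0] := cov x; pose n := maxn n0 t.
have tn : (t <= n)%N by apply: leq_maxr.
have [k ex] := hn0 n (leq_maxl _ _); have [a ea] := sub t n tn.
have e_n : (p ^ n.+1 = p ^ (n - t) * p ^ t.+1)%N by rewrite -expnD addnS subnK.
have /dvdnP[k' ek] : (p ^ (n - t) %| k)%N.
  have : (p ^ n.+1 %| k * p ^ t.+1)%N by apply/ord; rewrite expgnA -ex.
  by rewrite e_n dvdn_pmul2r.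
have /dvdnP[a' ea'] : (p ^ (n - t) %| a)%N.
  have : (p ^ n.+1 %| a * p ^ t.+1)%N by apply/ord; rewrite expgnA -ea; apply/ord.
  by rewrite e_n dvdn_pmul2r.
have cop : coprime a' (p ^ t.+1).
  apply: coprimeXr; rewrite coprime_sym prime_coprime //; apply/negP => /dvdnP[b eb].
  have : z t ^+ (p ^ t) = 1.
    rewrite ea -expgnA; apply/ord; rewrite ea' eb e_n expnS.
    by apply/dvdnP; exists b; rewrite -!mulnA; congr (_ * _)%N; rewrite mulnCA.
  by move/ord; rewrite dvdn_Pexp2l ?prime_gt1 // ltnn.
have a'_gt0 : (0 < a')%N.
  case: (posnP a') cop => // ->; rewrite /coprime gcd0n => /eqP e1.
  by have := prime_gt1 p_prime; have := ltn_expl t.+1 (prime_gt1 p_prime); rewrite e1.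
have [u v e _] := egcdnP (p ^ t.+1) a'_gt0.
rewrite (eqP cop) in e.
have gz : z n ^+ (p ^ (n - t)) = z t ^+ u.
  rewrite ea -expgnA ea' mulnAC [(a' * u)%N]mulnC e mulnDl mul1n expgnDr.
  rewrite -mulnA [(p ^ t.+1 * _)%N]mulnC -e_n.
  by have [_ ->] := ord n (v * p ^ n.+1)%N; rewrite ?mul1g // dvdn_mull.
have : gen [set z t] (z t) by apply: sub_gen.
move=> /(subgroupX u (subgroup_gen _)) /(subgroupX k' (subgroup_gen _)).
by rewrite -gz -expgnA mulnC -ek -ex.
Qed.

End Quasicyclic.

Section Toral.
Local Open Scope group_scope.
Local Open Scope classical_set_scope.
Local Open Scope card_scope.
Context {gT : groupType}.
Variables (p : nat) (S : set gT).
Hypotheses (p_prime : prime p) (S_toral : discrete_toral p S).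

(** The properties of the normal subgroup [S0], isomorphic to a finite power of
    [Z/p^oo], on which the finiteness arguments rest. *)
Record torus (S0 : set gT) : Prop := Torus {
  torus_subgroup : subgroup S0;
  torus_sub : S0 `<=` S;
  torus_abelian : forall x y, S0 x -> S0 y -> commute x y;
  torus_torsion : forall x, S0 x -> exists m, x ^+ (p ^ m) = 1;
  torus_divisible : forall x q, (0 < q)%N -> S0 x -> exists2 y, S0 y & y ^+ q = x;
  torus_finite : forall s, finite_set [set x | S0 x /\ x ^+ (p ^ s) = 1];
  torus_index : exists n, lcosets S S0 #= `I_n
}.

Lemma ffun_expE (Z : groupType) r (v : {ffun 'I_r -> Z}) n i :
  (v ^+ n) i = v i ^+ n.
Proof.
by elim: n => [|n IHn]; [rewrite !expg0 ffunE|rewrite !expgS ffunE IHn].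
Qed.

Lemma toral_torus : exists S0, torus S0.
Proof.
have [gS [S0 [[gS0 sS0 _] [Z [r [f [Zqc [fh finj fim]]]]] [n fin]]]] := S_toral.
exists S0.
have fX x k : S0 x -> f (x ^+ k) = f x ^+ k by apply: group_homX fh.
have f1 : f 1 = 1 by apply: group_hom1 fh.
have inj x y : S0 x -> S0 y -> f x = f y -> x = y.
  by move=> Sx Sy; apply: finj; apply: mem_set.
have surj v : exists2 x, S0 x & f x = v by have : setT v by []; rewrite -fim.
have [_ fM] := (group_homP _ _ _).1 fh.
have S0X x k : S0 x -> S0 (x ^+ k) by apply: subgroupX.
have S01 : S0 1 by apply: subgroup1.
split=> //; last by exists (p ^ n)%N.
- move=> x y Sx Sy; apply: inj; [exact: subgroupM|exact: subgroupM|].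
  rewrite !fM //; apply/ffunP=> i; rewrite !ffunE.
  exact: (quasicyclic_abelian Zqc).
- move=> x Sx; have /choice[m hm] i := quasicyclic_torsion Zqc (f x i).
  exists (\max_i m i)%N; apply: inj; rewrite ?fX ?f1 //; first exact: S0X.
  apply/ffunP=> i; rewrite ffun_expE ffunE.
  have le : (m i <= \max_i m i)%N by apply: (leq_bigmax (F := m)).
  by rewrite -(subnKC le) expnD expgnA hm expg1n.
- move=> x q q_gt0 Sx.
  have /choice[y hy] i := quasicyclic_divisible p_prime Zqc (f x i) q_gt0.
  have [w Sw ew] := surj [ffun i => y i]; exists w => //.
  apply: inj; rewrite ?fX ?ew //; first exact: S0X.
  by apply/ffunP=> i; rewrite ffun_expE ffunE hy.
move=> s; set W := [set x | _].
have injW : {in W &, injective f}.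
  by move=> x y /set_mem[Sx _] /set_mem[Sy _]; apply: inj.
rewrite -(eq_finite_set (inj_card_eq injW)).
apply: sub_finite_set (finite_ffun r (quasicyclic_finite p_prime Zqc s)).
by move=> _ [x [Sx ex] <-] i /=; rewrite -ffun_expE -fX // ex f1 ffunE.
Qed.

Variable S0 : set gT.
Hypothesis S0_torus : torus S0.
Let gS : subgroup S. Proof. by case: S_toral. Qed.
Let gS0 : subgroup S0. Proof. exact: torus_subgroup S0_torus. Qed.
Let sS0 : S0 `<=` S. Proof. exact: torus_sub S0_torus. Qed.
Let coset g : set gT := [set g * h | h in S0].

Let coset_mem g : S g -> lcosets S S0 (coset g).
Proof. by move=> Sg; exists g. Qed.

Let coset_eq g g' : coset g = coset g' -> S0 (g^-1 * g').
Proof.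
move=> e; have : coset g' g' by exists 1; rewrite ?mulg1 //; apply: subgroup1.
by rewrite -e => -[h S0h <-]; rewrite mulKg.
Qed.

Lemma torus_exponent : exists2 M, (0 < M)%N & forall x, S x -> S0 (x ^+ M).
Proof.
have [n fin] := torus_index S0_torus; exists n`!; rewrite ?fact_gt0 // => x Sx.
have SX k : S (x ^+ k) by apply: subgroupX.
have [inj|] := pselect (injective (fun i : 'I_n.+1 => coset (x ^+ i))).
  by have := inj_ord_bound fin (fun i : 'I_n.+1 => coset_mem (SX i)) inj; rewrite ltnn.
move=> /existsNP[i /existsNP[j /not_implyP[e ij]]].
have key (a b : nat) : coset (x ^+ a) = coset (x ^+ b) -> (a < b <= n)%N ->
    S0 (x ^+ n`!).
  move=> /coset_eq + /andP[ab bn]; rewrite -{1}(subnKC (ltnW ab)) expgnDr mulKg.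
  have /dvdnP[q ->] : (b - a %| n`!)%N.
    by rewrite dvdn_fact // subn_gt0 ab (leq_trans (leq_subr _ _)).
  by rewrite mulnC expgnA; apply: subgroupX.
case: (ltngtP i j) => h; last by case: ij; apply: val_inj.
  by apply: key e _; rewrite h -ltnS ltn_ord.
by apply: key (esym e) _; rewrite h -ltnS ltn_ord.
Qed.

(** An element of the torus is an [M]-th power, where [M] is such that all [M]-th
    powers lie in the torus, and so is its image. *)
Lemma torus_stable f x : group_hom S S f -> S0 x -> S0 (f x).
Proof.
move=> hf Sx; have [M M_gt0 hM] := torus_exponent.
have [y Sy <-] := torus_divisible S0_torus M_gt0 Sx.
rewrite (group_homX _ gS hf); last exact: sS0.
by apply: hM; case: hf => h _; apply/h/sS0.
Qed.

(** Modulo the torus the orbit of [x] is eventually periodic; if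
    [g (y) = y t] with [g] a power of [f] and [t] in the torus, then the orbit
    of [y] under [g] stays in [y W], where [W] is the finite subgroup of the
    elements of the torus whose order divides that of [t]. *)
Lemma toral_locally_finite : locally_finite_endos S.
Proof.
move=> f hf x Sx.
have iterS_ n : group_hom S S (iter n f).
  elim: n => [|n IHn]; first by apply/group_homP.
  case/group_homP: IHn => IH1 IH2; case/group_homP: hf => h1 h2.
  by apply/group_homP; split=> [u Su|u v Su Sv] /=; [auto|rewrite IH2 // h2 //; auto].
have Sf n u : S u -> S (iter n f u) by case: (iterS_ n) => h _; apply: h.
have [n fin] := torus_index S0_torus.
have [i [d [d_gt0 e]]] : exists i d, (0 < d)%N /\
    coset (iter (i + d) f x) = coset (iter i f x).
  apply: (@pigeonhole _ (lcosets S S0) (fun n => coset (iter n f x))).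
    by apply/finite_setP; exists n.
  by move=> r; apply/coset_mem/Sf.
set y := iter i f x in e; have Sy : S y by apply: Sf.
pose t := y^-1 * iter d f y.
have S0t : S0 t by apply: coset_eq; rewrite -iterD addnC.
have [m tm] := torus_torsion S0_torus S0t.
pose W := [set w | S0 w /\ w ^+ (p ^ m) = 1].
have Wg w : W w -> W (iter d f w).
  move=> [Sw ew]; split; first exact: torus_stable.
  rewrite -(group_homX _ gS (iterS_ d)); last exact: sS0.
  by rewrite ew (group_hom1 gS (iterS_ d)).
have WM w w' : W w -> W w' -> W (w * w').
  move=> [Sw ew] [Sw' ew']; split; first exact: subgroupM.
  by rewrite expgMn ?ew ?ew' ?mulg1 //; apply: torus_abelian S0_torus _ _ _ _.
have orb r : [set y * w | w in W] (iter (r * d) f y).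
  elim: r => [|r [w Ww ew]].
    by exists 1; rewrite ?mulg1 //; split; [exact: subgroup1|exact: expg1n].
  rewrite mulSn iterD -ew; exists (t * iter d f w); first by apply: WM => //; apply: Wg.
  case/group_homP: (iterS_ d) => _ h; rewrite h //; last by case: Ww => /sS0.
  by rewrite /t !mulgA mulgV mul1g.
have [a [b [b_gt0 eab]]] := pigeonhole
  (finite_image (fun w => y * w) (torus_finite S0_torus m)) orb.
exists (a * d + i)%N, (b * d)%N; rewrite muln_gt0 b_gt0 d_gt0; split=> //.
by rewrite addnAC -mulnDl !iterD -/y.
Qed.

Lemma order_p (x : gT) m : x ^+ (p ^ m) = 1 -> x <> 1 -> exists2 n, x ^+ n <> 1 & x ^+ n ^+ p = 1.
Proof.
elim: m x => [|m IHm] x; first by rewrite expg1.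
move=> xm x1; have [xp|xp] := pselect (x ^+ p = 1); first by exists 1%N; rewrite expg1.
rewrite expnS expgnA in xm; have [n h1 h2] := IHm _ xm xp.
by exists (p * n)%N; rewrite expgnA.
Qed.

(** In each factor choose an element [u i] different from [1], of order [p] in
    the torus if the factor meets the torus.  If [u i] and [u j] lie in the same
    coset of the torus, then applying [e i] to [(u i)^-1 (u j)] shows that [u i]
    lies in the torus, and so does [u j]; but there the [u i] are pairwise
    different.  So [i] is determined by the coset of [u i] together with [u i]
    itself when it lies in the torus. *)
Lemma toral_splitting_bound : exists B, forall (F : fusion gT) k (e : 'I_k -> gT -> gT),
  fusion_system F -> base F = S ->
  splitting F S e -> (forall i, ~ trivial_set (e i @` S)) -> (k <= B)%N.
Proof.
have [n fin] := torus_index S0_torus.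
pose A := lcosets S S0 `*` [set x | S0 x /\ x ^+ (p ^ 1) = 1].
have /finite_setP[B cA] : finite_set A.
  by apply: finite_setX; [apply/finite_setP; exists n|exact: torus_finite].
exists B => F k e F_fusion baseF sp nt.
have ne i : normal_endo F (e i) by exact: split_normal sp i.
have eS i x : S x -> S (e i x).
  by move=> Sx; have := normal_mem (ne i); rewrite baseF; apply.
have /choice[u hu] : forall i, exists u, [/\ S u, e i u = u, u <> 1 & S0 u -> u ^+ p = 1].
  move=> i.
  have fixe x : (e i @` S) x -> e i x = x.
    by move=> [y Sy <-]; have := @split_idem _ _ _ _ _ sp i; rewrite /idem baseF; apply.
  have [[x [Tx [S0x x1]]]|none] :=
    pselect (exists x, (e i @` S) x /\ S0 x /\ x <> 1).
    have [m /order_p/(_ x1)[q h1 h2]] := torus_torsion S0_torus S0x.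
    exists (x ^+ q); split=> //; first exact: (sS0 (subgroupX q gS0 S0x)).
    have hei : group_hom S S (e i) by have := normal_hom (ne i); rewrite baseF.
    by rewrite (group_homX _ gS hei) ?fixe //; apply: sS0.
  have [x [Tx x1]] : exists x, (e i @` S) x /\ x <> 1.
    apply: contrapT => h; apply: (nt i) => x Tx; apply: contrapT => x1.
    by apply: h; exists x.
  exists x; split=> //; first by case: Tx => y /eS h <-.
    exact: fixe.
  by move=> S0x; case: none; exists x.
pose v i := (coset (u i), if pselect (S0 (u i)) then u i else 1).
apply: (inj_ord_bound cA (u := v)) => [i|i j].
  have [Su _ _ up] := hu i; split; first exact: coset_mem.
  rewrite /v /=; case: pselect => h /=; first by rewrite expn1; auto.
  by split; [exact: subgroup1|exact: expg1n].
have orth a b : a != b -> e a (u b) = 1.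
  move=> ab; have [Su <- _ _] := hu b.
  by apply: (split_orth sp) => //; rewrite baseF.
have half a b : a != b -> coset (u a) = coset (u b) -> S0 (u a).
  move=> ab /coset_eq S0ab; have [Sa ea _ _] := hu a; have [Sb _ _ _] := hu b.
  have hea : group_hom S S (e a) by have := normal_hom (ne a); rewrite baseF.
  have := torus_stable hea S0ab; case/group_homP: (hea) => _ hM.
  rewrite hM //; last exact: subgroupV.
  by rewrite (group_homV gS hea) // ea orth // mulg1 => /(subgroupV gS0); rewrite invgK.
move=> vij; have ec : coset (u i) = coset (u j) := congr1 fst vij.
case: (eqVneq i j) => // ij; exfalso.
have S0i := half i j ij ec.
have S0j : S0 (u j) by apply: half (esym ec); rewrite eq_sym.
have := congr1 snd vij; rewrite /v /=.
case: (pselect (S0 (u i))) => [h /=|//]; case: (pselect (S0 (u j))) => [h' /=|//].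
move=> eu; have [_ ei u1 _] := hu i.
by case: u1; rewrite -ei eu; apply: orth.
Qed.

End Toral.

(** * Factorizations into indecomposable fusion subsystems *)

Section Factorization.
Local Open Scope group_scope.
Local Open Scope classical_set_scope.
Context {gT : groupType}.
Variable F : fusion gT.
Hypothesis F_fusion : fusion_system F.
Let S := base F.
Let gS : subgroup S. Proof. exact: base_subgroup F_fusion. Qed.
Local Notation normal_endo := (normal_endo F).
Local Notation idem := (idem F).
Local Notation primitive := (primitive F).
Implicit Types (P Q R T : set gT) (f g h c phi psi : gT -> gT).

Lemma trivial_setE T : T 1 -> trivial_set T -> T = [set 1].
Proof. by move=> T1 tT; apply/seteqP; split=> [x /tT|_ ->]. Qed.

Lemma fimage1 f : normal_endo f -> (f @` S) 1.
Proof. by move=> nf; exists 1; [exact: subgroup1|exact: (normal1 F_fusion nf)]. Qed.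

(** If [f] is an idempotent with image inside that of the idempotent [c], then
    [c] is the sum of the orthogonal idempotents [f c] and [(1 - f) c]. *)
Definition half f c (b : bool) := (if b then f else compl f) \o c.

Section Refine.
Variables f c : gT -> gT.
Hypotheses (nf : normal_endo f) (jf : idem f) (nc : normal_endo c) (jc : idem c).
Hypothesis sfc : f @` S `<=` c @` S.

Let cS x : S x -> S (c x). Proof. exact: normal_mem. Qed.
Let fS x : S x -> S (f x). Proof. exact: normal_mem. Qed.

Let cf x : S x -> c (f x) = f x.
Proof. by move=> Sx; apply: (idem_image jc); apply: sfc; exists x. Qed.

Lemma idem_compl x : S x -> f (compl f x) = 1.
Proof.
move=> Sx; rewrite /compl (normalM nf) //; last exact/(subgroupV gS)/fS.
by rewrite (normalV F_fusion nf) ?jf ?mulVg //; apply: fS.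
Qed.

Lemma compl_idem x : S x -> compl f (f x) = 1.
Proof. by move=> Sx; rewrite /compl jf // mulVg. Qed.

Let cfc x : S x -> c (compl f (c x)) = compl f (c x).
Proof.
move=> Sx; rewrite /compl (normalM nc) ?jc //; [|exact/(subgroupV gS)/fS/cS|exact: cS].
by rewrite (normalV F_fusion nc) ?cf //; [exact: cS|exact/fS/cS].
Qed.

Local Notation fc := (half f c).

Lemma half_normal b : normal_endo (fc b).
Proof.
by case: b; apply: (normal_comp F_fusion) => //; apply: (normal_compl F_fusion).
Qed.

Lemma half_image b x : S x -> c (fc b x) = fc b x.
Proof. by case: b => Sx; [apply: cf; apply: cS|apply: cfc]. Qed.

Lemma half_mul a b x : S x -> fc a (fc b x) = if a == b then fc b x else 1.
Proof.
move=> Sx; have Scx := cS Sx; case: a b => -[]; rewrite /half /= ?cf ?cfc ?jf //.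
- exact: idem_compl.
- exact: compl_idem.
by rewrite {1}/compl idem_compl // invg1 mul1g.
Qed.

Lemma half_inj x : S x -> (forall b, fc b x = 1) -> c x = 1.
Proof.
move=> Sx h; rewrite -(mul_compl f (c x)).
by have := h true; have := h false; rewrite /half /= => -> ->; rewrite mulg1.
Qed.

Lemma half_kill b x : c x = 1 -> fc b x = 1.
Proof.
move=> cx; case: b; rewrite /half /= cx; first exact: (normal1 F_fusion nf).
by rewrite /compl (normal1 F_fusion nf) invg1 mulg1.
Qed.

Lemma half_true : fc true @` S = f @` S.
Proof.
apply/seteqP; split=> [_ [x Sx <-]|_ [x Sx <-]]; first by exists (c x) => //; apply: cS.
by exists (f x); [exact: fS|rewrite /half /= cf ?jf].
Qed.

Lemma half_false : ~ (c @` S `<=` f @` S) -> ~ trivial_set (fc false @` S).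
Proof.
move=> nsub tr; apply: nsub => _ [x Sx <-]; exists (c x); first exact: cS.
have : fc false x = 1 by apply: tr; exists x.
by rewrite /half /= -{3}(mul_compl f (c x)) => ->; rewrite mulg1.
Qed.

Lemma half_proper : ~ trivial_set (f @` S) ->
  ~ (c @` S `<=` fc false @` S).
Proof.
move=> nt sub; apply: nt => _ [x Sx <-].
have [y Sy e] := sub (f x) (sfc (ex_intro2 _ _ x Sx erefl)).
by rewrite -jf // -e; apply: idem_compl; apply: cS.
Qed.

End Refine.

(** A normal idempotent contradicting primitivity decomposes the full subsystem
    by [half], with both factors over proper subgroups. *)
Lemma indecomposable_primitive c : normal_endo c -> idem c ->
  indecomposable (full F (c @` S)) -> primitive (c @` S).
Proof.
move=> nc jc indec f nf jf sfc; set T := c @` S in indec sfc *.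
apply: contrapT => /not_orP[nt nfull]; apply: indec.
have oT : obj F T by apply: (obj_image (normal_hom nc)); split.
pose b (i : 'I_2) := i == ord0.
have b_inj i j : i != j -> b i == b j = false.
  by case: i j => -[|[|//]] ? [[|[|//]] ?].
have sp : splitting F T (fun i : 'I_2 => half f c (b i)).
  split=> [i|i x Sx|i j x ij Sx|i _ [x Sx <-]|x Tx h].
  - exact: half_normal.
  - by rewrite (half_mul nf jf nc jc sfc) // eqxx.
  - by rewrite (half_mul nf jf nc jc sfc) // b_inj.
  - rewrite -(half_image nf nc jc sfc) //; exists (half f c (b i) x) => //.
    by apply: normal_mem => //; apply: half_normal.
  have Sx : S x by case: oT => _; apply.
  rewrite -(idem_image jc Tx); apply: (half_inj (f := f)) => // -[].
    by have := h ord0.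
  by have := h ord_max.
have [com dp] := splitting_dprod F_fusion oT sp.
exists (fun i => full F (half f c (b i) @` S)); split=> // i /=.
split; first exact: (@split_image _ _ _ _ _ sp i).
rewrite /b; case: (i == ord0); last exact: (half_proper nf jf nc sfc).
by rewrite (half_true nf jf nc jc sfc).
Qed.

(** The factors of a decomposition over proper subgroups are images of normal
    idempotents, hence trivial by primitivity; then so is their product, which
    has no proper subgroup. *)
Lemma primitive_indecomposable c : normal_endo c -> idem c ->
  primitive (c @` S) -> indecomposable (full F (c @` S)).
Proof.
move=> nc jc prim [E [prop _ dE]].
have [e sp eE] := dprod_splitting F_fusion nc jc dE.
have tr i : trivial_set (e i @` S).
  case: (prim (e i)) => //.
  - exact: split_normal sp i.
  - exact: (@split_idem _ _ _ _ _ sp i).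
  - exact: (@split_image _ _ _ _ _ sp i).
  by move=> full_i; have := prop i; rewrite eE => -[_].
have := prop ord0; rewrite eE => -[_]; apply=> x Tx /=.
have Sx : S x by apply: image_base nc _ Tx.
have -> : x = 1 by apply: (split_inj sp) => // i; apply: (tr i); exists x.
exact/fimage1/(split_normal sp).
Qed.

(** For a single factor the nontriviality comes from that of [S] rather than from
    the definition of a factorization. *)
Lemma factorization_splitting k (E : 'I_k -> fusion gT) :
  indecomposable_factorization F E -> exists e,
  [/\ splitting F S e, forall i, E i = full F (e i @` S),
      forall i, primitive (e i @` S)
    & ~ trivial_set S -> forall i, ~ trivial_set (e i @` S)].
Proof.
move=> [k_gt0 dE indec nt].
have nid : normal_endo id by apply: normal_id.
have dE' : fus_dprod (full F (id @` S)) E by rewrite image_id full_base.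
have [e] := dprod_splitting F_fusion nid (fun _ _ => erefl) dE'.
rewrite image_id => sp eE; exists e; split=> // [i|ntS i tr].
  apply: indecomposable_primitive.
  - exact: split_normal sp i.
  - exact: (@split_idem _ _ _ _ _ sp i).
  by rewrite -eE.
have [k1|] := ltnP 1 k.
  apply: (nt k1 i); rewrite eE; apply: trivial_setE => //.
  exact/fimage1/(split_normal sp).
move=> k1; apply: ntS => x Sx; apply: (split_inj sp) => // j.
suff -> : j = i by apply: tr; exists x.
have ord_eq0 (l : 'I_k) : l = 0%N :> nat.
  by apply/eqP; rewrite -leqn0 -ltnS (leq_trans (ltn_ord l)).
by apply: val_inj; rewrite /= !ord_eq0.
Qed.

Lemma fus_image_full a T : normal_endo a -> inv_on F S a -> T `<=` S ->
  fus_image a (full F T) = full F (a @` T).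
Proof.
move=> na [b nb hb] sT.
have bK x : S x -> a (b x) = x by case/hb.
have aK x : S x -> b (a x) = x by case/hb.
apply: fusion_eq => // P Q psi; split=> [[P0 [Q0 [phi [[h sP sQ] -> -> e]]]]|[h sP sQ]].
  have [chi hchi echi] := normal_lift F_fusion na h.
  split; [|exact: image_subset|exact: image_subset].
  by apply: (Hom_ext F_fusion hchi) => _ [x Px <-]; rewrite e // echi.
have [chi hchi echi] := normal_lift F_fusion nb h.
have sub A : A `<=` a @` T -> b @` A `<=` T /\ A = a @` (b @` A).
  move=> sA; split=> [_ [_ /sA[t Tt <-] <-]|]; first by rewrite aK //; apply: sT.
  rewrite image_comp -[LHS]image_id; apply: eq_imagel => _ /sA[t /sT St <-] /=.
  by rewrite bK //; apply: normal_mem.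
have [sbP eP] := sub P sP; have [sbQ eQ] := sub Q sQ.
exists (b @` P), (b @` Q), chi; split=> // _ [x Px <-].
have Sx : S x by case: (Hom_dom F_fusion h) => _; apply.
have Sp : S (psi x) by apply: (Hom_base F_fusion h).
by rewrite bK // echi // bK.
Qed.

Hypothesis F_chain : chain_closed F.
Hypothesis S_endos : locally_finite_endos S.

(** Splittings into nontrivial factors have bounded length, and a factor that
    is not primitive can be split further. *)
Lemma primitive_splitting B :
  (forall k (e : 'I_k -> gT -> gT), splitting F S e ->
    (forall i, ~ trivial_set (e i @` S)) -> (k <= B)%N) ->
  ~ trivial_set S -> exists k (e : 'I_k -> gT -> gT),
    [/\ splitting F S e, forall i, ~ trivial_set (e i @` S) &
        forall i, primitive (e i @` S)].
Proof.
move=> bound ntS; apply: contrapT => none.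
suff claim n : exists2 e : nat -> gT -> gT,
    splitting F S (fun i : 'I_n.+1 => e i) &
    forall i : 'I_n.+1, ~ trivial_set (e i @` S).
  by have [e sp nt] := claim B; have := bound _ _ sp nt; rewrite ltnn.
elim: n => [|k [e sp nt]].
  exists (fun=> id) => [|_]; last by rewrite image_id.
  split=> [_|_ x _|i j|_|x _ /(_ ord0)//]; first exact: normal_id.
  - by [].
  - by rewrite !ord1.
  by rewrite image_id.
have [i0 [f [nf jf sf ntf nfull]]] : exists (i0 : 'I_k.+1) f, [/\ normal_endo f, idem f,
    f @` S `<=` e i0 @` S, ~ trivial_set (f @` S) & ~ (e i0 @` S `<=` f @` S)].
  apply: contrapT => h; apply: none; exists k.+1, (fun i : 'I_k.+1 => e i).
  split=> // i f nf jf sf; apply: contrapT => /not_orP[h1 h2].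
  by apply: h; exists i, f; split.
pose c := e i0.
have nc : normal_endo c by exact: split_normal sp i0.
have jc : idem c by exact: (@split_idem _ _ _ _ _ sp i0).
(* [f c] takes the place of [c], and [(1 - f) c] is added at the end *)
pose e' n := if n == i0 :> nat then half f c true
             else if n == k.+1 then half f c false else e n.
have case_e' (i : 'I_k.+2) :
    (exists b, e' i = half f c b /\
       nat_of_ord i = if b then nat_of_ord i0 else k.+1) \/
    (exists j : 'I_k.+1, [/\ e' i = e j, nat_of_ord i = j & j != i0]).
  rewrite /e'; case: (eqVneq (i : nat) i0) => [ii|ii]; first by left; exists true.
  case: (eqVneq (i : nat) k.+1) => [ik|ik]; first by left; exists false.
  have ltk : (i < k.+1)%N by rewrite ltn_neqAle ik -ltnS ltn_ord.
  by right; exists (Ordinal ltk); split.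
have nhalf b : normal_endo (half f c b) by apply: half_normal.
have hS b x : S x -> S (half f c b x) by apply: normal_mem.
have eS (j : 'I_k.+1) x : S x -> S (e j x).
  by apply: normal_mem; exact: split_normal sp j.
have hmul := half_mul nf jf nc jc sf.
have orth (i j : 'I_k.+1) x : i != j -> S x -> e i (e j x) = 1.
  by move=> ij Sx; have := split_orth sp ij Sx.
exists e'.
  split.
  - move=> i; case: (case_e' i) => [[b [-> _]]|[j [-> _ _]]] //.
    exact: split_normal sp j.
  - move=> i x Sx; case: (case_e' i) => [[b [-> _]]|[j [-> _ _]]].
      by have := hmul b b x Sx; rewrite eqxx.
    by have := @split_idem _ _ _ _ _ sp j; apply.
  - move=> i j x ij Sx.
    case: (case_e' i) => [[b [-> ib]]|[i' [-> ii ni]]];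
    case: (case_e' j) => [[b' [-> jb]]|[j' [-> jj nj]]].
    + have := hmul b b' x Sx; case: eqP => [bb|_ -> //].
      by case/eqP: ij; apply: val_inj; rewrite /= ib jb bb.
    + by apply: (half_kill nf); apply: orth; rewrite // eq_sym.
    + by rewrite -(half_image nf nc jc sf) //; apply: orth => //; apply: hS.
    + apply: orth => //; apply: contra ij => /eqP e_ij.
      by apply/eqP/val_inj; rewrite /= ii jj e_ij.
  - by move=> i; apply: image_base; case: (case_e' i) => [[b [-> _]]|[j [-> _ _]]] //;
    exact: split_normal sp j.
  move=> x Sx h; apply: (split_inj sp) => // i; case: (eqVneq i i0) => [->|ni].
    apply: (half_inj (f := f)) => // -[].
      have := h (widen_ord (leqnSn _) i0); rewrite /e' /= eqxx; apply.
    have := h ord_max; rewrite /e' /= eqxx.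
    by case: eqP => // e1; have := ltn_ord i0; rewrite -e1 ltnn.
  have := h (widen_ord (leqnSn _) i); rewrite /e' /= (inj_eq val_inj) (negbTE ni).
  by case: eqP => // e1; have := ltn_ord i; rewrite e1 ltnn.
move=> i; case: (case_e' i) => [[[] [-> _]]|[j [-> _ _]]]; last exact: nt.
  by rewrite (half_true nf jf nc jc sf).
exact: (half_false nc nfull).
Qed.

Lemma factorization_exists B :
  (forall k (e : 'I_k -> gT -> gT), splitting F S e ->
    (forall i, ~ trivial_set (e i @` S)) -> (k <= B)%N) ->
  exists (k : nat) (E : 'I_k -> fusion gT), indecomposable_factorization F E.
Proof.
move=> bound; have oS : obj F S by split.
have dprod k (e : 'I_k -> gT -> gT) : splitting F S e ->
    fus_dprod F (fun i => full F (e i @` S)).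
  by move=> sp; have [_] := splitting_dprod F_fusion oS sp; rewrite full_base.
have indec k (e : 'I_k -> gT -> gT) : splitting F S e ->
    (forall i, primitive (e i @` S)) ->
    forall i, indecomposable (full F (e i @` S)).
  move=> sp pe i; apply: primitive_indecomposable => //.
    exact: split_normal sp i.
  exact: (@split_idem _ _ _ _ _ sp i).
have [tS|ntS] := pselect (trivial_set S).
  have sp : splitting F S (fun _ : 'I_1 => id).
    split=> [_|_ x _|i j|_|x _ /(_ ord0)//]; first exact: normal_id.
    - by [].
    - by rewrite !ord1.
    by rewrite image_id.
  exists 1%N, (fun=> full F (id @` S)); split=> //; first exact: dprod sp.
  apply: (indec _ _ sp) => _ f nf _ _; left=> x Tx; apply: tS.
  exact: image_base Tx.
have [k [e [sp nt pe]]] := primitive_splitting bound ntS.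
exists k, (fun i => full F (e i @` S)); split=> //.
- case: k e sp nt pe => // e sp _ _; case: ntS => x Sx.
  by apply: (split_inj sp) => // -[].
- exact: dprod.
- exact: indec.
by move=> _ i /= e1; apply: (nt i); rewrite e1.
Qed.

(** The exchange theorem in both directions gives equality of the numbers of
    factors.  It needs nontrivial factors, so a trivial [S] is treated apart. *)
Lemma factorization_unique k m (E : 'I_k -> fusion gT) (E' : 'I_m -> fusion gT) :
  indecomposable_factorization F E -> indecomposable_factorization F E' ->
  exists (ekm : k = m) (sigma : 'S_k) (alpha : gT -> gT),
    normal_aut F alpha /\
    forall i : 'I_k, fus_image alpha (E i) = E' (cast_ord ekm (sigma i)).
Proof.
move=> fE fE'; have [e [sp eE pe nte]] := factorization_splitting fE.
have [e' [sp' eE' pe' nte']] := factorization_splitting fE'.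
have [tS|ntS] := pselect (trivial_set S).
  have triv l (E0 : 'I_l -> fusion gT) e0 : splitting F S e0 ->
      (forall i, E0 i = full F (e0 i @` S)) -> indecomposable_factorization F E0 ->
      l = 1%N /\ forall i, e0 i @` S = [set 1].
    move=> sp0 eE0 [l_gt0 _ _ nt].
    have e1 i : e0 i @` S = [set 1].
      have n0 : normal_endo (e0 i) by exact: split_normal sp0 i.
      apply: trivial_setE; first exact: fimage1.
      by move=> x Tx; apply: tS; apply: image_base Tx.
    split=> //; apply/eqP; rewrite eqn_leq l_gt0 andbT leqNgt; apply/negP => l1.
    by apply: (nt l1 (Ordinal l_gt0)); rewrite eE0 /= e1.
  have [k1 eS] := triv _ _ _ sp eE fE; have [m1 eS'] := triv _ _ _ sp' eE' fE'.
  subst k m; exists erefl, 1%g, id.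
  have nid : normal_endo id by apply: normal_id.
  have iid : inv_on F S id by exists id.
  split; first exact: normal_endo_aut.
  move=> i; rewrite eE eE' eS eS' fus_image_full ?image_id //.
  by move=> _ ->; apply: subgroup1.
have [a [s [na ia si im]]] := exchange F_fusion F_chain S_endos sp sp'
  (fun i => conj (pe i) (nte ntS i)) pe'.
have [_ [s' [_ _ si' _]]] := exchange F_fusion F_chain S_endos sp' sp
  (fun i => conj (pe' i) (nte' ntS i)) pe.
have ekm : k = m.
  have := leq_card s si; have := leq_card s' si'; rewrite !card_ord => mk km.
  by apply/eqP; rewrite eqn_leq km.
subst m; exists erefl, (perm si), a; split; first exact: normal_endo_aut.
move=> i; rewrite cast_ord_id permE eE eE' -im fus_image_full //.
by apply: image_base; exact: split_normal sp i.
Qed.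

End Factorization.

Theorem theoremA (p : nat) (gT : groupType) (F : fusion gT)
    (p_prime : prime p) (F_fusion : fusion_system F)
    (S_toral : discrete_toral p (base F)) (F_saturated : saturated p F) :
  (exists (k : nat) (E : 'I_k -> fusion gT),
     indecomposable_factorization F E) /\
  (forall (k m : nat) (E : 'I_k -> fusion gT) (E' : 'I_m -> fusion gT),
     indecomposable_factorization F E ->
     indecomposable_factorization F E' ->
     exists (ekm : k = m) (sigma : 'S_k) (alpha : gT -> gT),
       normal_aut F alpha /\
       forall i : 'I_k,
         fus_image alpha (E i) = E' (cast_ord ekm (sigma i))).
Proof.
have [S0 S0_torus] := toral_torus p_prime S_toral.
have [_ F_chain] := F_saturated; split; last first.
  move=> k m E E'; apply: factorization_unique => //.
  exact: (toral_locally_finite S_toral S0_torus).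
have [B hB] := toral_splitting_bound S_toral S0_torus.
by apply: (@factorization_exists _ _ F_fusion B) => k e; apply: hB.
Qed.
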